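(* Let $\Omega\subset\mathbb{R}^2$ be a bounded polygonal domain with boundary $\Gamma$ having at most one non-convex corner. Let $f\in V'$ and $u\in V_\Gamma'$. Then there exists a unique $y\in L^2(\Omega)$ such that $$(y,\Delta v)_\Omega=(u,\partial_n v)_\Gamma-(f,v)_\Omega\qquad\text{for all } v\in V,$$ and it satisfies $$\|y\|_{L^2(\Omega)}\le \|u\|_{V_\Gamma'}+\|f\|_{V'}.$$
   Context: $V:=\{v\in H^1_0(\Omega):\Delta v\in L^2(\Omega)\}$ (distributional Laplacian), endowed with the norm $\|v\|_V:=\|\Delta v\|_{L^2(\Omega)}$, which is equivalent to the graph norm. For $v\in V$ the outward normal derivative $\partial_n v$ on $\Gamma$ is understood through the Green formula $(\partial_n v,\chi)_\Gamma=(\nabla v,\nabla\chi)_\Omega+(\Delta v,\chi)_\Omega$ for all $\chi\in H^1(\Omega)$. $V_\Gamma:=\{\partial_n v: v\in V\}$, with norm $\|g\|_{V_\Gamma}:=\inf\{\|v\|_V: v\in V,\ \partial_n v=g\}$. Primes denote dual spaces with the usual dual norms. $(w,v)_G:=\int_G wv$ denotes the $L^2(G)$ scalar product or the corresponding duality pairing; thus $(u,\partial_n v)_\Gamma$ is the $V_\Gamma'$–$V_\Gamma$ pairing and $(f,v)_\Omega$ the $V'$–$V$ pairing. *)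

(* Defs.v *)
From HB Require Import structures.
From mathcomp Require Import all_boot all_order all_algebra.
From mathcomp Require Import all_classical all_reals all_analysis.

Set Implicit Arguments.
Unset Strict Implicit.
Unset Printing Implicit Defensive.
Import Order.TTheory GRing.Theory Num.Theory.
Import numFieldNormedType.Exports.

Local Open Scope classical_set_scope.
Local Open Scope ring_scope.

Section PolygonalDomains.
Context {R : realType}.
Implicit Types (Omega : set (R * R)) (p a b : R * R).

Definition boundary Omega : set (R * R) := closure Omega `\` Omega°.

Definition closed_segment a b : set (R * R) :=
  [set a + t *: (b - a) | t in [set t : R | 0 <= t <= 1]].

Definition open_sector p (theta omega : R) : set (R * R) :=
  [set x | exists r t : R, [/\ 0 < r, theta < t < theta + omega &
                              x = p + (r * cos t, r * sin t)]].

Definition interior_angle Omega p (omega : R) :=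
  0 < omega < 2 * pi /\
  exists theta : R, \forall x \near p, Omega x <-> open_sector p theta omega x.

(* The angle condition at every boundary point (angle pi away from the        *)
(* corners) makes Omega a Lipschitz domain: cracks and points where several   *)
(* components of the boundary touch are excluded, holes are not.              *)
Definition bounded_polygonal_domain Omega :=
  [/\ open Omega, connected Omega, Omega !=set0 & bounded_set Omega] /\
  (exists s : seq ((R * R) * (R * R)),
     boundary Omega = \bigcup_(ab in [set` s]) closed_segment ab.1 ab.2) /\
  (forall p, boundary Omega p -> exists omega, interior_angle Omega p omega).

Definition nonconvex_corner Omega p :=
  boundary Omega p /\ exists2 omega : R, pi < omega & interior_angle Omega p omega.

Definition at_most_one_nonconvex_corner Omega :=
  forall p q, nonconvex_corner Omega p -> nonconvex_corner Omega q -> p = q.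

End PolygonalDomains.

(* An element of a function space on Omega is represented by any function     *)
(* R * R -> R with the required properties on Omega; equality in the space is *)
(* equality almost everywhere on Omega. The norms below only see these        *)
(* classes, and hence so do the bounded linear functionals.                   *)
Notation lebesgue2 R :=
  (@lebesgue_measure R \x @lebesgue_measure R)%E (only parsing).

Section FunctionSpaces.
Context {R : realType}.
Variable Omega : set (R * R).
Implicit Types (v w g phi chi : R * R -> R) (i : 'I_2).

Definition zero_ext v : R * R -> R := patch (cst 0) Omega v.

Definition L2 : set (R * R -> R) :=
  [set v | zero_ext v \in Lfun (lebesgue2 R) 2%:E].

Definition L2_inner v w : R := \int[lebesgue2 R]_(x in Omega) (v x * w x).

Definition L2_norm v : R := fine ('N[lebesgue2 R]_2%:E[EFin \o zero_ext v])%E.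

Definition basis_vec i : R * R := if i == ord0 then (1, 0) else (0, 1).

Definition partial i phi : R * R -> R := 'D_(basis_vec i) phi.

Definition iter_partial (s : seq 'I_2) phi : R * R -> R := foldr partial phi s.

Definition smooth phi := forall s : seq 'I_2,
  continuous (iter_partial s phi) /\
  forall i x, derivable (iter_partial s phi) x (basis_vec i).

(* C_c^oo(Omega), extended by zero to the plane *)
Definition test_function : set (R * R -> R) :=
  [set phi | [/\ smooth phi, compact (closure [set x | phi x != 0]) &
                 closure [set x | phi x != 0] `<=` Omega]].

Definition weak_partial i v g := forall phi, test_function phi ->
  L2_inner v (partial i phi) = - L2_inner g phi.

Definition weak_laplacian v w := forall phi, test_function phi ->
  L2_inner v (\sum_(i < 2) partial i (partial i phi)) = L2_inner w phi.

Definition H1 : set (R * R -> R) :=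
  [set v | L2 v /\ forall i, exists2 g, L2 g & weak_partial i v g].

(* Representatives of the weak derivatives, unique up to a null set. *)
Definition wpartial i v : R * R -> R :=
  xget (cst 0) [set g | L2 g /\ weak_partial i v g].

Definition laplacian v : R * R -> R :=
  xget (cst 0) [set w | L2 w /\ weak_laplacian v w].

Definition grad_inner v chi : R :=
  \sum_(i < 2) L2_inner (wpartial i v) (wpartial i chi).

Definition H1_norm v : R := Num.sqrt (L2_inner v v + grad_inner v v).

Definition H10 : set (R * R -> R) :=
  [set v | H1 v /\ forall eps : R, 0 < eps ->
                   exists2 phi, test_function phi & H1_norm (v - phi) < eps].

Definition V : set (R * R -> R) :=
  [set v | H10 v /\ exists2 w, L2 w & weak_laplacian v w].

Definition V_norm v : R := L2_norm (laplacian v).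

(* The normal derivative on the boundary, as the functional                   *)
(* chi |-> (d_n v, chi)_Gamma on H^1(Omega) given by the Green formula. It     *)
(* vanishes on H^1_0(Omega), i.e. depends only on the trace of chi.           *)
Definition normal_derivative v : H1 -> R :=
  fun chi : H1 => grad_inner v (\val chi) + L2_inner (laplacian v) (\val chi).

Definition VGamma : set (H1 -> R) := [set normal_derivative v | v in V].

Definition VGamma_norm (g : H1 -> R) : R :=
  inf [set V_norm v | v in [set v | V v /\ normal_derivative v = g]].

End FunctionSpaces.
Arguments normal_derivative {R} Omega v.
Arguments VGamma {R} Omega _.
Arguments VGamma_norm {R} Omega g.

(* The dual of a linear subspace S normed by N; only the values on S of a     *)
(* functional matter.                                                         *)
Section Dual.
Context {R : realType} {E : lmodType R}.
Variables (S : set E) (N : E -> R).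

Definition dual : set (E -> R) :=
  [set f | (forall (a : R) v w, S v -> S w -> f (a *: v + w) = a * f v + f w) /\
           exists C : R, forall v, S v -> `|f v| <= C * N v].

Definition dual_norm (f : E -> R) : R :=
  sup [set `|f v| | v in [set v | S v /\ N v <= 1]].

End Dual.

(* Main.v *)
(* Only openness and boundedness of [Omega] matter: the Laplacian is then an
   isometry of [V] onto [L^2(Omega)]. Surjectivity is the solvability of the
   Dirichlet problem: by the Poincare inequality and the completeness of [L^2], a
   minimizing sequence of the Dirichlet energy among test functions converges
   in [H^1_0]. The right-hand side [v |-> u(d_n v) - f(v)] is therefore a bounded
   functional of the Laplacian of [v], with bound the sum of the two dual norms,
   and [y] is its Riesz representer.

   Elements of the function spaces are functions, and the representatives
   [wpartial] and [laplacian] are linear only up to null sets; this rests on the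
   du Bois-Reymond lemma [ae_eq0_of_test], proved with smooth bumps converging to
   the indicators of open boxes, which generate the product sigma-algebra. *)

Require Import Defs.
From HB Require Import structures.
From mathcomp Require Import all_boot all_order all_algebra.
From mathcomp Require Import all_classical all_reals all_analysis.
From mathcomp Require Import measurable_realfun.
From mathcomp Require Import ring lra.
Set Implicit Arguments.
Unset Strict Implicit.
Unset Printing Implicit Defensive.
Import Order.TTheory GRing.Theory Num.Theory.
Import numFieldNormedType.Exports.
Local Open Scope classical_set_scope.
Local Open Scope ring_scope.

(** * Minimizing sequences of quadratic functionals *)

(** The lemma of this section is used twice. With the Dirichlet form on test functions it solves the
    Dirichlet problem; with the form [(laplacian v, laplacian w)] on [V] it produces the representer
    [y]. Elements are functions rather than classes, so the form is only semidefinite and its domain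
    only a linear set of functions. The lemma therefore returns a sequence, and every limit is taken
    in [L^2(Omega)]. Surjectivity of the Laplacian enters once [y] is built. The difference of two
    solutions [z] and [y] is some [laplacian v], and testing with this [v] gives [|z - y|^2 = 0].
    Similarly, if [laplacian v = y] and [M] is the sum of the dual norms, then [|y|^2 = u (d_n v) -
    f v <= M |v|_V = M |y|]. The infimum that defines the norm of [V_Gamma] is used through
    [|d_n v| <= |v|_V]: the functional [u] is pulled back to [V], and all scaling takes place
    there. *)

Section MinimizingSequence.
Context {R : realType} {E : lmodType R}.
Variables (K : set E) (a : E -> E -> R) (F : E -> R).
Hypothesis K0 : K 0.
Hypothesis KZD : forall c x y, K x -> K y -> K (c *: x + y).
Hypothesis a_sym : forall x y, K x -> K y -> a x y = a y x.
Hypothesis a_linear : forall c x y z, K x -> K y -> K z ->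
  a (c *: x + y) z = c * a x z + a y z.
Hypothesis a_ge0 : forall x, K x -> 0 <= a x x.
Hypothesis F_linear : forall c x y, K x -> K y -> F (c *: x + y) = c * F x + F y.
Hypothesis F_bounded : exists C, forall x, K x -> F x ^+ 2 <= C * a x x.

Let J x := a x x - 2 * F x.

Let a_quadratic c x y : K x -> K y ->
  a (c *: x + y) (c *: x + y) = c ^+ 2 * a x x + 2 * c * a x y + a y y.
Proof.
move=> Kx Ky; have Kxy := KZD c Kx Ky.
rewrite a_linear// [a x _]a_sym// [a y _]a_sym// !a_linear// [a y x]a_sym//.
by ring.
Qed.

(* The approximate Riesz representer of [F]: by the parallelogram law, minimizing
   sequences of [a x x - 2 F x] are Cauchy, even if [K] is not complete. *)
Lemma minimizing_sequence : exists k : nat -> E,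
  [/\ forall n, K (k n),
      forall n m, a (k n - k m) (k n - k m) <= 2 * (n.+1%:R^-1 + m.+1%:R^-1) &
      forall n x, K x -> (a (k n) x - F x) ^+ 2 <= a x x * n.+1%:R^-1].
Proof.
have [C FC] := F_bounded.
(* With [A = a x x] and [D = |C|], the bound [4 F^2 <= 4 D A <= (A + D)^2] gives [2 F <= A + D]. *)
have Jlb x : K x -> - `|C| <= J x.
  move=> Kx; rewrite /J; have := FC x Kx; have := a_ge0 Kx.
  have := ler_norm C; have := normr_ge0 C.
  set A := a x x; set f := F x; set D := `|C| => D0 CD A0 fC.
  have fD : f ^+ 2 <= D * A by apply: le_trans fC _; rewrite ler_wpM2r.
  have : (2 * f) ^+ 2 <= (A + D) ^+ 2 by have := sqr_ge0 (A - D); nra.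
  have [f0 |f0 _] := leP 0 f; last lra.
  by rewrite ler_sqr ?nnegrE ?mulr_ge0 ?addr_ge0//; lra.
pose S := [set J x | x in K].
have S0 : S !=set0 by exists (J 0); exists 0.
have lbS : has_lbound S by exists (- `|C|) => _ [x Kx <-]; exact: Jlb.
have infS x : K x -> inf S <= J x by move=> Kx; apply: ge_inf => //; exists x.
have ex n : exists x, K x /\ J x < inf S + n.+1%:R^-1.
  have [|_ [x Kx <-] Jx] := @inf_adherent R S n.+1%:R^-1 _ (conj S0 lbS); first by rewrite invr_gt0.
  by exists x.
have [k kP] := choice ex.
have Kk n := (kP n).1; have Jk n := (kP n).2.
exists k; split => // [n m|n x Kx].
  (* The midpoint [h] of [x] and [y] satisfies [2 J x + 2 J y - 4 J h = a (x - y) (x - y)]. Here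
     [J h >= inf S], while [J (k n)] and [J (k m)] are close to [inf S]. *)
  have Kh : K (2^-1 *: k n + (2^-1 *: k m)).
    by apply: KZD => //; rewrite -[_ *: k m]addr0; exact: KZD.
  have := infS _ Kh; have := Jk n; have := Jk m; rewrite /J.
  have e : a (k n - k m) (k n - k m) = a (k n) (k n) - 2 * a (k n) (k m) + a (k m) (k m).
    rewrite addrC -scaleN1r a_quadratic// [a (k m) (k n)]a_sym//; ring.
  have K2 : K (2^-1 *: k m) by rewrite -[_ *: _]addr0; exact: KZD.
  have e1 z : K z -> a z (2^-1 *: k m) = 2^-1 * a z (k m).
    move=> Kz; rewrite a_sym// -[2^-1 *: k m]addr0 a_linear// [a (k m) _]a_sym//.
    by have := a_linear 1 K0 K0 Kz; rewrite scaler0 addr0; lra.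
  have e2 : F (2^-1 *: k m) = 2^-1 * F (k m).
    by have := F_linear 1 K0 K0; have := F_linear 2^-1 (Kk m) K0; rewrite scaler0 !addr0; lra.
  rewrite a_quadratic// F_linear// e2 !e1// [a (2^-1 *: _) _]a_sym// e1// e.
  move: (n.+1%:R^-1) (m.+1%:R^-1) => en em; lra.
(* Since [J (k n)] is within [1/(n+1)] of the infimum, adding [t x] to [k n] lowers [J] by at most
   that much. This quadratic polynomial in [t] is thus nonnegative, and its discriminant gives the
   bound. *)
have q t : 0 <= t ^+ 2 * a x x + 2 * t * (a (k n) x - F x) + n.+1%:R^-1.
  have := infS _ (KZD t Kx (Kk n)); have := Jk n.
  rewrite /J a_quadratic// F_linear// [a x (k n)]a_sym//.
  by move: (n.+1%:R^-1) => en; lra.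
move: q; have : 0 < n.+1%:R^-1 :> R by rewrite invr_gt0.
set e := n.+1%:R^-1; set A := a x x; set B := a (k n) x - F x => e0 q.
have [A0|] := ltP 0 A.
  have := q (- B / A); rewrite (_ : _ + e = e - B ^+ 2 / A); last by field; rewrite gt_eqF.
  by rewrite subr_ge0 ler_pdivrMr// [e * _]mulrC.
rewrite le_eqVlt ltNge a_ge0// orbF => /eqP A0; rewrite A0 in q *.
(* With [A = 0] the polynomial is affine, and [t = - e / B] would give it the value [- e]. *)
have [->|B0] := eqVneq B 0; first by rewrite expr0n/= mul0r.
have := q (- e / B); rewrite (_ : _ + e = - e); last by field.
by lra.
Qed.

End MinimizingSequence.

(** * The plane and its [L^2] spaces *)

Section Plane.
Context {R : realType}.
Local Notation plane := (measurableTypeR R * measurableTypeR R)%type.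
Implicit Types (a b : R * R) (U : set (R * R)) (f : R * R -> R).
Lemma ae_imply (P Q : R * R -> Prop) : (forall x, P x -> Q x) ->
  {ae lebesgue2 R, forall x, P x} -> {ae lebesgue2 R, forall x, Q x}.
Proof.
by move=> PQ; apply: filterS; [exact: (ae_filter_ringOfSetsType (lebesgue2 R))|exact: PQ].
Qed.

Definition open_box (a b : R * R) : set (R * R) := `]a.1, b.1[ `*` `]a.2, b.2[.

Definition closed_box a b : set (R * R) := `[a.1, b.1] `*` `[a.2, b.2].

Lemma open_box_closed a b : open_box a b `<=` closed_box a b.
Proof.
move=> x [/= + +]; rewrite !in_itv/= => /andP[? ?] /andP[? ?].
by split; rewrite /= in_itv/= !ltW.
Qed.

(** Corners of the square with rational centre [q.1] and half side [1/(q.2 + 1)]. The index type is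
    countable, so these squares serve for countable unions and for almost everywhere statements. *)
Definition rational_lo (q : rat * rat * nat) : R * R :=
  (ratr q.1.1 - q.2.+1%:R^-1, ratr q.1.2 - q.2.+1%:R^-1).
Definition rational_hi (q : rat * rat * nat) : R * R :=
  (ratr q.1.1 + q.2.+1%:R^-1, ratr q.1.2 + q.2.+1%:R^-1).

Lemma open_rational_box U x : open U -> U x -> exists q,
  open_box (rational_lo q) (rational_hi q) x /\
  closed_box (rational_lo q) (rational_hi q) `<=` U.
Proof.
move=> oU Ux; have /nbhs_ballP[e /= e0 xU] := open_nbhs_nbhs (conj oU Ux).
(* The centre is within one half side of [x], and the closed square within one half side of its
   centre, hence the [e / 2]. *)
have [n] : exists n, 0 + n.+1%:R^-1 < e / 2 by apply: ltr_add_invr; rewrite divr_gt0.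
rewrite add0r => ne; have n0 : 0 < n.+1%:R^-1 :> R by rewrite invr_gt0.
have ex (y : R) : exists q : rat, `|ratr q - y| < n.+1%:R^-1.
  have [|r [yr [q _ qr]]] := @dense_rat R (ball y n.+1%:R^-1) (ex_intro _ y (ballxx y n0)).
    exact: ball_open.
  by exists q; move: yr; rewrite -qr distrC.
have [q1 q1P] := ex x.1; have [q2 q2P] := ex x.2; exists (q1, q2, n).
move: q1P q2P ne n0; rewrite /rational_lo /rational_hi /open_box /closed_box /=.
move: (n.+1%:R^-1) => r; rewrite !ltr_distlC => /andP[? ?] /andP[? ?] re r0; split.
  by split; rewrite /= in_itv/=; lra.
move=> z [/=]; rewrite !in_itv/= => /andP[? ?] /andP[? ?]; apply: xU.
by split; rewrite /ball/= ltr_distlC; lra.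
Qed.

(** Degenerate corners are allowed: they give the empty box and make the family stable under
    intersection. *)
Definition open_boxes : set (set (R * R)) := [set B | exists a b, B = open_box a b].

Lemma open_box_measurable a b : measurable (open_box a b : set plane).
Proof. by apply: measurableX; exact: measurable_itv. Qed.

Lemma open_boxI a b c d : open_box a b `&` open_box c d =
  open_box (Num.max a.1 c.1, Num.max a.2 c.2) (Num.min b.1 d.1, Num.min b.2 d.2).
Proof.
rewrite /open_box -setXI; apply/seteqP; split=> -[x y] /=;
  rewrite !in_itv/= !gt_max !lt_min.
  by move=> [[/andP[-> ->] /andP[-> ->]] [/andP[-> ->] /andP[-> ->]]].
by move=> [/andP[/andP[-> ->] /andP[-> ->]] /andP[/andP[-> ->] /andP[-> ->]]].
Qed.

Lemma open_boxes_setI : setI_closed open_boxes.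
Proof.
move=> _ _ [a [b ->]] [c [d ->]].
by rewrite open_boxI; eexists; eexists.
Qed.

(** An open set is the countable union of the rational boxes that it contains. This links the
    topology of the plane to the product sigma-algebra. *)
Lemma open_sigma_boxes U : open U -> <<s open_boxes >> U.
Proof.
move=> oU; pose B q := open_box (rational_lo q) (rational_hi q).
pose F q := if `[< B q `<=` U >] then B q else set0.
have -> : U = \bigcup_q F q.
  apply/seteqP; split => [x Ux|x [q _]]; last first.
    by rewrite /F; case: ifPn => // /asboolP + Bx; exact.
  have [q [Bx BU]] := open_rational_box oU Ux.
  exists q => //; rewrite /F; case: ifPn => // /asboolP[].
  exact: subset_trans (@open_box_closed _ _) BU.
apply: (@countable_bigcupT_measurable _ (g_sigma_algebraType open_boxes)) => // q.
rewrite /F; case: ifP => _; last exact: sigma_algebra0.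
by apply: sub_sigma_algebra; exists (rational_lo q), (rational_hi q).
Qed.

Lemma open_measurable2 U : open U -> measurable (U : set plane).
Proof.
move=> /open_sigma_boxes; apply: smallest_sub; first exact: sigma_algebra_measurable.
by move=> _ [a [b ->]]; exact: open_box_measurable.
Qed.

(** The two projections are measurable for the sigma-algebra of boxes, because the preimage of an
    open interval is open; hence all measurable rectangles belong to it. This is the form that
    Dynkin induction requires. *)
Lemma plane_measurableE : @measurable _ plane = <<s open_boxes >>.
Proof.
apply/seteqP; split; last first.
  apply: smallest_sub; first exact: sigma_algebra_measurable.
  by move=> _ [a [b ->]]; exact: open_box_measurable.
have mproj (p : R * R -> R) (A : set (measurableTypeR R)) : continuous p ->
    measurable A -> <<s open_boxes >> (p @^-1` A).
  move=> cp mA; rewrite -[_ @^-1` _]setTI.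
  suff mp : measurable_fun (setT : set (g_sigma_algebraType open_boxes)) p by exact: mp.
  apply: (measurability _ (RGenOpens.measurableE R)).
  move=> _ [_ [c [d ->] <-]]; rewrite setTI; apply: open_sigma_boxes.
  by move/continuousP : cp; apply; exact: interval_open.
rewrite measurable_prod_measurableType; apply: smallest_sub.
  exact: smallest_sigma_algebra.
move=> _ [A mA [C mC <-]].
rewrite (_ : A `*` C = (fst @^-1` A) `&` (snd @^-1` C))//.
apply: (@measurableI _ (g_sigma_algebraType open_boxes)).
  by apply: mproj => // x; exact: cvg_fst.
by apply: mproj => // x; exact: cvg_snd.
Qed.

Lemma continuous_measurable_fun2 f : continuous f -> measurable_fun (setT : set plane) f.
Proof.
move=> cf; apply: (measurability _ (measurable_realfun.RGenOpens.measurableE R)).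

move=> _ [_ [a [b ->] <-]]; rewrite setTI; apply: open_measurable2.
by move/continuousP : cf; apply; exact: interval_open.
Qed.
End Plane.

(** * The inner product of [L^2(Omega)] on functions *)

Section L2Theory.
Context {R : realType} (Omega : set (R * R)).
Local Notation plane := (measurableTypeR R * measurableTypeR R)%type.
Hypothesis mO : measurable (Omega : set plane).
Implicit Types v w z : R * R -> R.
Local Notation mu := (lebesgue2 R).
Local Notation ip := (L2_inner Omega).

Let zero_extE v : zero_ext Omega v = v \_ Omega.
Proof. by []. Qed.

Lemma L2P v : L2 Omega v <->
  measurable_fun (Omega : set plane) v /\ (\int[mu]_(x in Omega) (v x ^+ 2)%:E < +oo)%E.
Proof.
have e : ('N[mu]_2%:E[EFin \o zero_ext Omega v] =
          (\int[mu]_(x in Omega) (v x ^+ 2)%:E) `^ 2^-1)%E.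
  rewrite unlock; congr (_ `^ _)%E; rewrite [RHS]integral_mkcond.
  apply: eq_integral => x _; rewrite /= /zero_ext !patchE /=.
  case: ifP => _; last by rewrite normr0 powR0.
  by rewrite powR_mulrn// real_normK// num_real.
have i0 : (0 <= \int[mu]_(x in Omega) (v x ^+ 2)%:E)%E.
  by apply: integral_ge0 => x _; rewrite lee_fin sqr_ge0.
rewrite /L2/= inE/= /finite_norm; split=> [/andP[]|[mv iv]].
  rewrite !inE/= /finite_norm zero_extE => mv; rewrite -zero_extE e => iv.
  split; first by apply/measurable_restrictT.
  by rewrite (@lty_poweRy _ _ 2^-1).
apply/andP; rewrite !inE/= /finite_norm e; split.
  exact: (measurable_restrictT v mO).1.
by rewrite poweR_lty.
Qed.

Lemma L2_measurable v : L2 Omega v -> measurable_fun (Omega : set plane) v.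
Proof. by case/L2P. Qed.

Lemma L2_integrable_mul v w : L2 Omega v -> L2 Omega w ->
  mu.-integrable Omega (EFin \o (v \* w)).
Proof.
move=> Lv Lw; have /Lfun1_integrable := Lfun2_mul_Lfun1 Lv Lw.
move=> i; have {}i := integrableS (@measurableT _ plane) mO (@subsetT _ _) i.
apply: eq_integrable i => // x /[!inE] Ox.
by rewrite /= /zero_ext !patchE mem_set.
Qed.

Lemma L2_0 : L2 Omega (cst 0).
Proof.
apply/L2P; split; first exact: measurable_cst.
by rewrite integral0_eq// => x _; rewrite expr0n.
Qed.

Lemma L2_integrable_sqr v : L2 Omega v -> mu.-integrable Omega (fun x => (v x ^+ 2)%:E).
Proof. by move=> Lv; exact: (L2_integrable_mul Lv Lv). Qed.

(** The dominating function comes from [(c v + w)^2 <= 2 c^2 v^2 + 2 w^2]. *)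
Lemma L2ZD c v w : L2 Omega v -> L2 Omega w -> L2 Omega (c *: v + w).
Proof.
move=> Lv Lw; have [mv _] := (L2P v).1 Lv; have [mw _] := (L2P w).1 Lw.
have m : measurable_fun (Omega : set plane) (c *: v + w).
  by apply: measurable_funD => //; exact: measurable_funM.
apply/L2P; split => //.
have i := integrableD mO (integrableZl mO (2 * c ^+ 2) (L2_integrable_sqr Lv))
                         (integrableZl mO 2 (L2_integrable_sqr Lw)).
apply: le_lt_trans (integrable_lty mO i).
apply: ge0_le_integral => //=.
- by move=> x _; rewrite lee_fin sqr_ge0.
- by apply/measurable_EFinP; exact: measurable_funX.
- by case/integrableP : i.
- move=> x Ox; rewrite -!EFinM -EFinD lee_fin.
  rewrite !fctE; change (c *: v x) with (c * v x).
  have := sqr_ge0 (c * v x - w x); nra.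
Qed.

Lemma L2_innerC v w : ip v w = ip w v.
Proof. by apply: eq_Rintegral => x _; rewrite mulrC. Qed.

Lemma L2_inner_linear c v w z : L2 Omega v -> L2 Omega w -> L2 Omega z ->
  ip (c *: v + w) z = c * ip v z + ip w z.
Proof.
move=> Lv Lw Lz; have ivz := L2_integrable_mul Lv Lz.
rewrite /L2_inner -RintegralZl// -RintegralD//; last 2 first.
- exact: (integrableZl mO c ivz).
- exact: L2_integrable_mul.
by apply: eq_Rintegral => x _; rewrite mulrA -mulrDl.
Qed.

Lemma L2_inner_ge0 v : 0 <= ip v v.
Proof. by apply: Rintegral_ge0 => x _; rewrite -expr2 sqr_ge0. Qed.

Lemma L2_inner0 v : ip (cst 0) v = 0.
Proof.
rewrite /L2_inner /Rintegral integral0_eq// => x _.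
by rewrite mul0r.
Qed.

Lemma L2_norm_sqrt v : L2 Omega v -> L2_norm Omega v = Num.sqrt (ip v v).
Proof.
move=> Lv; rewrite /L2_norm unlock.
have i0 : (0 <= \int[mu]_(x in Omega) (v x * v x)%:E)%E.
  by apply: integral_ge0 => x _; rewrite lee_fin -expr2 sqr_ge0.
rewrite (_ : (\int[_]_x _)%E = \int[mu]_(x in Omega) (v x * v x)%:E)%E; last first.
  rewrite [RHS]integral_mkcond.
  apply: eq_integral => x _; rewrite /= /zero_ext !patchE /=.
  case: ifP => _; last by rewrite normr0 powR0.
  by rewrite powR_mulrn// real_normK// num_real.
rewrite -[X in (X `^ _)%E]fineK; last first.
  by apply: integrable_fin_num => //; exact: L2_integrable_mul.
by rewrite -powR12_sqrt// L2_inner_ge0.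
Qed.

Lemma ae_L2_inner v w z : measurable_fun (Omega : set plane) v ->
  measurable_fun (Omega : set plane) w ->
  measurable_fun (Omega : set plane) z ->
  {ae mu, forall x, Omega x -> v x = w x} -> ip v z = ip w z.
Proof.
move=> mv mw mz vw; congr fine; apply: ae_eq_integral => //.
- by apply/measurable_EFinP; exact: measurable_funM.
- by apply/measurable_EFinP; exact: measurable_funM.
by apply: ae_imply vw => x xO Ox /=; rewrite xO.
Qed.

Lemma L2_inner_eq0 v : L2 Omega v -> ip v v = 0 ->
  {ae mu, forall x, Omega x -> v x = 0}.
Proof.
move=> Lv v0; have i := L2_integrable_mul Lv Lv.
have mv : measurable_fun (Omega : set plane) (EFin \o (v \* v)) by case/integrableP : i.
have /(ae_eq_integral_abs mu mO mv) : (\int[mu]_(x in Omega) `|(v x * v x)%:E| = 0)%E.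
  rewrite -[RHS]/(0%:E) -v0 /L2_inner /Rintegral fineK; last exact: integrable_fin_num.
  by apply: eq_integral => x _; rewrite gee0_abs// lee_fin -expr2 sqr_ge0.
apply: ae_imply => x /[apply] /=; case => /eqP.
by rewrite mulf_eq0 orbb => /eqP.
Qed.

Lemma L2_inner_CS v w : L2 Omega v -> L2 Omega w ->
  ip v w ^+ 2 <= ip v v * ip w w.
Proof.
move=> Lv Lw.
have q t : 0 <= t ^+ 2 * ip v v + 2 * t * ip v w + ip w w.
  have := L2_inner_ge0 (t *: v + w).
  rewrite L2_inner_linear//; last exact: L2ZD.
  rewrite [ip v (_ + _)]L2_innerC [ip w (_ + _)]L2_innerC !L2_inner_linear//.
  by rewrite [ip w v]L2_innerC; lra.
move: q; have := L2_inner_ge0 v; have := L2_inner_ge0 w.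
move: (ip v v) (ip v w) (ip w w) => A B C C0 A0 q.
have [Agt0|] := ltP 0 A.
  have := q (- B / A); rewrite (_ : _ + C = C - B ^+ 2 / A); last by field; rewrite gt_eqF.
  by rewrite subr_ge0 ler_pdivrMr// [C * _]mulrC.
rewrite le_eqVlt ltNge A0 orbF => /eqP A00; rewrite A00 in q *.
have [->|B0] := eqVneq B 0; first by rewrite expr0n/= mul0r.
(* With [A = 0] the polynomial is affine; this [t] is where it would equal [-1]. *)
have := q (- (C + 1) / (2 * B)); rewrite (_ : _ + C = - 1); last by field.
by lra.
Qed.

End L2Theory.

(** * Completeness of [L^2(Omega)] *)

Lemma limn_einf_le {R : realType} (u : nat -> \bar R) (c : \bar R) :
  (\forall n \near \oo, u n <= c)%E -> (limn_einf u <= c)%E.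
Proof.
move=> uc; rewrite limn_einf_lim; apply: lime_le.
  exact: is_cvg_einfs.
apply: filterS uc => n; apply: le_trans.
by apply: ereal_inf_lbound; exists n => /=.
Qed.

(* The weights [4 ^ k] force [|u (k + 1) - u k| = O(2 ^ - k)]. *)
Lemma cvg_of_weighted_squares {R : realType} (u : nat -> R) :
  (\sum_(0 <= k <oo) (4 ^+ k * (u k.+1 - u k) ^+ 2)%:E)%E \is a fin_num -> cvgn u.
Proof.
set S := (\sum_(_ <= _ <oo) _)%E => Sfin.
have dS k : 4 ^+ k * (u k.+1 - u k) ^+ 2 <= fine S.
  rewrite -lee_fin fineK//; apply: (@le_trans _ _
    (\sum_(0 <= i < k.+1) (4 ^+ i * (u i.+1 - u i) ^+ 2)%:E)%E).
    rewrite big_nat_recr//= leeDr// sume_ge0// => i _.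
    by rewrite lee_fin mulr_ge0 ?sqr_ge0 ?exprn_ge0.
  apply: nneseries_lim_ge => i _ _.
  by rewrite lee_fin mulr_ge0 ?sqr_ge0 ?exprn_ge0.
have bd k : `|telescope u k| <= geometric (Num.sqrt (fine S)) 2^-1 k.
  rewrite /geometric /telescope /= exprVn ler_pdivlMr ?exprn_gt0//.
  rewrite -[X in _ * X]ger0_norm ?exprn_ge0// -normrM -sqrtr_sqr ler_wsqrtr//.
  by rewrite exprMn -exprM mulnC exprM -[2 ^+ 2]/(2 * 2) -natrM mulrC; exact: dS.
have : cvgn (series (telescope u)).
  apply: normed_cvg.
  apply: (series_le_cvg _ _ bd (is_cvg_geometric_series _)) => //.
    by move=> k; rewrite /geometric/= mulr_ge0 ?sqrtr_ge0 ?exprn_ge0.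
  by rewrite ger0_norm// invf_lt1// ltr1n.
move=> /cvg_ex[l ul]; apply/cvg_ex; exists (u 0%N + l).
rewrite {1}(_ : u = (fun n => u 0%N + series (telescope u) n)); last first.
  by apply/funext => n; rewrite -eq_sum_telescope.
by apply: cvgD => //; exact: cvg_cst.
Qed.

Section Completeness.
Context {R : realType} (Omega : set (R * R)).
Local Notation plane := (measurableTypeR R * measurableTypeR R)%type.
Hypothesis mO : measurable (Omega : set plane).
Local Notation mu := (lebesgue2 R).
Local Notation ip := (L2_inner Omega).

Lemma integral_sqrE (v : R * R -> R) : L2 Omega v ->
  (\int[mu]_(x in Omega) (v x ^+ 2)%:E = (ip v v)%:E)%E.
Proof.
move=> Lv; rewrite /L2_inner /Rintegral fineK//.
by apply: integrable_fin_num => //; exact: (L2_integrable_mul mO).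
Qed.

(** Riesz-Fischer: along a fast subsequence the weighted sum of squared increments is integrable,
    hence finite almost everywhere, which gives a pointwise limit. Fatou's lemma then turns it into
    an [L^2] limit of the whole sequence. *)
Lemma L2_complete (v : nat -> R * R -> R) : (forall n, L2 Omega (v n)) ->
  (forall e : R, 0 < e -> exists N, forall n m, (N <= n)%N -> (N <= m)%N ->
    ip (v n - v m) (v n - v m) <= e) ->
  exists2 w, L2 Omega w & forall e : R, 0 < e -> exists N, forall n, (N <= n)%N ->
    ip (v n - w) (v n - w) <= e.
Proof.
move=> Lv cauchy.
have LB f g : L2 Omega f -> L2 Omega g -> L2 Omega (f - g).
  by move=> Lf Lg; rewrite addrC -scaleN1r; exact: L2ZD.
(* The factor [4 ^ k] cancels the weight of the [k]-th increment and leaves [1 / 2 ^ (k + 1)], whose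
   sum is [1]. *)
pose eps k : R := (2 ^ (k + 1))%:R^-1 / 4 ^+ k.
have eps0 k : 0 < eps k by rewrite divr_gt0 ?exprn_gt0// invr_gt0 ltr0n expn_gt0.
have [N NP] := choice (fun k => cauchy _ (eps0 k)).
(* The sum is an index beyond all of [N 0, ..., N k]. *)
pose phi k := (\sum_(j < k.+1) N j)%N.
have Nphi j k : (j <= k)%N -> (N j <= phi k)%N.
  by move=> jk; rewrite /phi (bigD1 (Ordinal (jk : (j < k.+1)%N)))//= leq_addr.
pose u k := v (phi k).
pose S x := (\sum_(0 <= k <oo) (4 ^+ k * (u k.+1 x - u k x) ^+ 2)%:E)%E.
have mv n : measurable_fun (Omega : set plane) (v n) by exact: (L2_measurable mO).
have mB2 (f g : R * R -> R) : measurable_fun (Omega : set plane) f ->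
    measurable_fun (Omega : set plane) g ->
    measurable_fun (Omega : set plane) (fun x => (f x - g x) ^+ 2).
  by move=> mf mg; apply: measurable_funX; apply: measurable_funB.
have muk k : measurable_fun (Omega : set plane) (u k) by exact: mv.
have mSk k : measurable_fun (Omega : set plane)
    (fun x => (4 ^+ k * (u k.+1 x - u k x) ^+ 2)%:E).
  apply/measurable_EFinP; apply: measurable_funM => //.
  exact: mB2.
have S0 k x : (0 <= (4 ^+ k * (u k.+1 x - u k x) ^+ 2)%:E)%E.
  by rewrite lee_fin mulr_ge0 ?sqr_ge0 ?exprn_ge0.
have mS : measurable_fun (Omega : set plane) S.
  by apply: ge0_emeasurable_sum => // k x _ _; exact: S0.
have iS : mu.-integrable Omega S.
  apply/integrableP; split => //.
  under eq_integral do rewrite gee0_abs ?nneseries_ge0//.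
  rewrite integral_nneseries//.
  apply: (@le_lt_trans _ _ (\sum_(0 <= k <oo) (1 / (2 ^ (k + 1))%:R)%:E)%E); last first.
    by rewrite (cvg_lim _ (@cvg_geometric_eseries_half R 1 0))// ltry.
  apply: lee_nneseries => [k _ _|k _]; first exact: integral_ge0.
  under eq_integral do rewrite EFinM.
  rewrite ge0_integralZl_EFin//; last 2 first.
    - by move=> x _; rewrite lee_fin sqr_ge0.
    - by apply/measurable_EFinP; exact: mB2.
  rewrite (integral_sqrE (LB _ _ (Lv _) (Lv _))) -EFinM lee_fin.
  rewrite mulrC -ler_pdivlMr ?exprn_gt0// div1r.
  by apply: NP; apply: Nphi.
have cvgu : {ae mu, forall x, Omega x -> cvgn (u^~ x)}.
  by apply: ae_imply (integrable_ae mO iS) => x + Ox => /(_ Ox); exact: cvg_of_weighted_squares.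
(* The upper limit is measurable and defined everywhere; it is the limit of [u] wherever that
   exists. *)
pose w x := fine (limn_esup (fun k => (u k x)%:E)).
have mw : measurable_fun (Omega : set plane) w.
  apply: (measurableT_comp (fine_measurable measurableT)).
  apply: measurable_fun_limn_esup => k; exact/measurable_EFinP.
have uw : {ae mu, forall x, Omega x -> u^~ x @ \oo --> w x}.
  apply: ae_imply cvgu => x + Ox => /(_ Ox) cu.
  have /cvg_limn_einf_sup[_] : (fun k => (u k x)%:E) @ \oo --> (limn (u^~ x))%:E.
    by apply: cvg_EFin; [exact: nearW|exact: cu].
  by rewrite /w => ->.
have mBu n j : measurable_fun (Omega : set plane) (fun x => ((v n x - u j x) ^+ 2)%:E).
  by apply/measurable_EFinP; exact: mB2.
have mliminf n : measurable_fun (Omega : set plane)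
    (fun x => limn_einf (fun j => ((v n x - u j x) ^+ 2)%:E)).
  rewrite (_ : (fun x => _) =
    (fun x => - limn_esup (-%E \o (fun j => ((v n x - u j x) ^+ 2)%:E)))%E); last first.
    by apply/funext => x; rewrite limn_esupN oppeK.
  apply: measurableT_comp => //; apply: measurable_fun_limn_esup => j.
  by apply: measurableT_comp => //; exact: mBu.
(* Fatou in [j]: the integrand is the limit of [(v n - u j)^2], whose integrals are at most [eps k]
   for [j >= k]. *)
have bound k n : (N k <= n)%N ->
    (\int[mu]_(x in Omega) ((v n x - w x) ^+ 2)%:E <= (eps k)%:E)%E.
  move=> Nkn.
  rewrite (ae_eq_integral
    (fun x : plane => limn_einf (fun j => ((v n x - u j x) ^+ 2)%:E)))//; last 2 first.
  - by apply/measurable_EFinP; exact: mB2.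
  - apply: ae_imply uw => x /[apply] ux /=.
    have /cvg_limn_einf_sup[-> _]// :
      (fun j => ((v n x - u j x) ^+ 2)%:E) @ \oo --> ((v n x - w x) ^+ 2)%:E.
    apply: cvg_EFin; first exact: nearW.
    have c : (fun j => v n x - u j x) @ \oo --> v n x - w x.
      by apply: cvgB; [exact: cvg_cst|exact: ux].
    by apply: cvgM; exact: c.
  apply: le_trans (fatou _ mO (fun j => mBu n j) _) _.
  - by move=> j x _; rewrite lee_fin sqr_ge0.
  apply: limn_einf_le; exists k => // j /= kj.
  rewrite (integral_sqrE (LB _ _ (Lv _) (Lv _))) lee_fin.
  by apply: NP => //; apply: Nphi.
have L2vw k n : (N k <= n)%N -> L2 Omega (v n - w).
  move=> Nk; apply/(L2P mO); split; first exact: measurable_funB.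
  by apply: le_lt_trans (bound _ _ Nk) _; rewrite ltry.
exists w.
  have -> : w = v (N 0%N) - (v (N 0%N) - w) by rewrite opprB addrC subrK.
  by apply: LB => //; exact: (L2vw 0%N).
move=> e e0; have [k ke] := ltr_add_invr e0.
exists (N k) => n Nk; rewrite -lee_fin -(integral_sqrE (L2vw _ _ Nk)).
apply: le_trans (bound _ _ Nk) _; rewrite lee_fin.
apply/ltW/(le_lt_trans _ ke); rewrite add0r /eps.
apply: (@le_trans _ _ (2 ^ (k + 1))%:R^-1).
  rewrite ler_pdivrMr ?exprn_gt0// ler_peMr ?invr_ge0// exprn_ege1// ler1n//.
by rewrite lef_pV2 ?posrE ?ltr0n ?expn_gt0// ler_nat addn1 ltnW// ltn_expl.
Qed.
End Completeness.

(** * Smooth bumps *)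

Section Flat.
Context {R : realType} (c : R).
Hypothesis c0 : 0 < c.
Implicit Types (P : {poly R}) (s t : R).

(* [P(1/s) exp(-c/s)], extended by [0]: a family stable under derivation. *)
Definition flat P s : R := if 0 < s then P.[s^-1] * expR (- (c / s)) else 0.

(** For [0 < s < 1], [|P(1/s)|] is at most [M / s^d], while [exp(c/s)] exceeds the term
    [(c/s)^(d+2) / (d+2)!] of its series. The two spare powers leave [s^2], enough for a zero
    derivative at [0]. *)
Let flat_bound P : exists2 C, 0 <= C & forall s, `|s| < 1 -> `|flat P s| <= C * s ^+ 2.
Proof.
pose d := size P; pose M : R := \sum_(i < d) `|P`_i|.
have M0 : 0 <= M by apply: sumr_ge0.
have K0 : 0 <= M * (d.+2)`!%:R / c ^+ d.+2.
  by apply: divr_ge0; [exact: mulr_ge0|exact/exprn_ge0/ltW].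
exists (M * (d.+2)`!%:R / c ^+ d.+2) => //.
move=> s s1; rewrite /flat; case: ifPn => [s0|_]; last first.
  by rewrite normr0; apply: mulr_ge0 => //; exact: sqr_ge0.
have t1 : 1 <= s^-1 by rewrite invf_ge1// ltW// -(ger0_norm (ltW s0)).
have t0 : 0 < s^-1 by rewrite invr_gt0.
have PM : `|P.[s^-1]| <= M * s^-1 ^+ d.
  rewrite horner_coef /M mulr_suml; apply: le_trans (ler_norm_sum _ _ _) _.
  apply: ler_sum => i _; rewrite normrM ler_wpM2l// normrX ger0_norm ?(ltW t0)//.
  by rewrite ler_weXn2l// ltnW.
have eM : expR (- (c / s)) <= (d.+2)`!%:R / (c / s) ^+ d.+2.
  rewrite expRN invf_ple ?posrE ?expR_gt0 ?divr_gt0 ?exprn_gt0 ?ltr0n ?fact_gt0//; last first.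
    by rewrite divr_gt0.
  rewrite invf_div; apply: le_trans (expR_ge1Dxn d.+1 _); last by rewrite divr_ge0// ltW.
  by rewrite lerDr.
rewrite normrM (ger0_norm (expR_ge0 _)).
apply: le_trans (ler_pM (normr_ge0 _) (expR_ge0 _) PM eM) _.
rewrite le_eqVlt; apply/orP; left; apply/eqP.
rewrite expr_div_n !exprS exprVn; field.
by rewrite !expf_neq0 !gt_eqF.
Qed.

(** The chain rule with [t = 1/s] and [dt/ds = - t^2] turns [P] into [X^2 (c P - P')]. At [0] the
    difference quotient is [O(h)] by the quadratic bound. *)
Lemma is_derive_flat P s :
  is_derive s 1 (flat P) (flat ('X^2 * (c *: P - P^`())) s).
Proof.
have [s0|s0|<-] := ltgtP 0 s.
- apply: (@near_eq_is_derive _ _ _ (fun s => P.[s^-1] * expR (- (c * s^-1)))).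
    near=> u; rewrite /flat ifT//; near: u.
    by exists s => //= u; rewrite /ball/= ltr_distlC => /andP[]; lra.
  have dV : is_derive s 1 (fun u : R => u^-1) (- s ^- 2).
    by apply: is_derive_eq (is_deriveV _ (is_derive_id s 1)) _; rewrite ?gt_eqF//= scaler1.
  have dP : is_derive s 1 (fun u : R => P.[u^-1]) (P^`().[s^-1] * - s ^- 2).
    have dh (x : R) : is_derive x (1 : R) (horner P : R -> R) P^`().[x].
      apply: DeriveDef; first exact: derivable_horner.
      by rewrite -derive1E -(derivE P).
    exact: (@is_derive1_comp _ (horner P) (fun u => u^-1) s _ _ (dh _) dV).
  have dE : is_derive s 1 (fun u : R => expR (- (c * u^-1)))
      (expR (- (c * s^-1)) * (c * s ^- 2)).
    have dN : is_derive s 1 (fun u : R => - (c * u^-1)) (c * s ^- 2).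
      by apply: (is_derive_eq (is_deriveN (is_deriveZ c dV))); rewrite scalerN opprK.
    exact: (@is_derive1_comp _ expR (fun u => - (c * u^-1)) s _ _ (is_derive_expR _) dN).
  apply: is_derive_eq (is_deriveM dP dE) _.
  rewrite /flat s0 !hornerE /=; rewrite /GRing.scale/= -exprVn; ring.
- apply: (@near_eq_is_derive _ _ _ (cst 0)).
    near=> u; rewrite /flat ifF//; near: u.
    exists (- s); rewrite /= ?oppr_gt0// => u.
    by rewrite /ball/= ltr_distlC => /andP[] *; apply/negbTE; rewrite -leNgt; lra.
  by apply: is_derive_eq; rewrite /flat ifF// ltNge (ltW s0).
- rewrite {2}/flat ltxx.
  have [C C0 CP] := flat_bound P.
  suff h : (fun h : R => h^-1 *: (flat P (h *: (1:R) + 0) - flat P 0)) @ 0^' --> (0 : R).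
    by split; [apply/cvg_ex; exists 0|apply/cvg_lim].
  apply/cvgrPdist_le => e e0; near=> h.
  have h1 : `|h| < 1.
    near: h; apply: nbhs_dnbhs; exists 1 => //= h.
    by rewrite /ball/= sub0r normrN.
  have hC : `|h| * C <= e.
    near: h; apply: nbhs_dnbhs; exists (e / (C + 1)) => /=; first by rewrite divr_gt0 ?ltr_wpDl.
    move=> h; rewrite /ball/= sub0r normrN ltr_pdivlMr ?ltr_wpDl// => hC.
    by have := normr_ge0 h; nra.
  have hN0 : h != 0 by near: h; exact: nbhs_dnbhs_neq.
  rewrite sub0r normrN addr0 {2}/flat ltxx subr0 normrZ normfV /GRing.scale/= mulr1.
  rewrite ler_pdivrMl ?normr_gt0//; apply: le_trans (CP _ h1) _.
  rewrite -(real_normK (num_real h)); have := normr_ge0 h; nra.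
Unshelve. all: by end_near. Qed.
End Flat.

(** * Partial derivatives as derivatives along coordinate lines *)

Section Lines.
Context {R : realType}.
Implicit Types (i j : 'I_2) (p : R * R) (phi : R * R -> R).

Definition coord i p : R := if i == ord0 then p.1 else p.2.
Definition line i p (s : R) : R * R := if i == ord0 then (s, p.2) else (p.1, s).

Lemma line_coord i p : line i p (coord i p) = p.
Proof. by rewrite /line /coord; case: (i == ord0); case: p. Qed.

Lemma coord_line i p s : coord i (line i p s) = s.
Proof. by rewrite /line /coord; case: (i == ord0). Qed.

Lemma line_line i p s t : line i (line i p s) t = line i p t.
Proof. by rewrite /line /coord; case: (i == ord0). Qed.

(** The two difference quotients are the same function of [h], so derivability and the value of the
    derivative both transfer by rewriting. *)
Let quotient_line phi i p :
  (fun h : R => h^-1 *: ((phi \o shift p) (h *: basis_vec i) - phi p)) =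
  (fun h : R => h^-1 *: (((phi \o line i p) \o shift (coord i p)) (h *: 1) -
    (phi \o line i p) (coord i p))).
Proof.
apply/funext => h /=; rewrite line_coord; congr (_ *: (phi _ - _)).
rewrite /basis_vec /line /coord /shift /=; case: (i == ord0); case: p => a b /=;
  rewrite /GRing.scale /= /GRing.add /=; congr pair => /=.
- by rewrite scaler0 add0r.
- by rewrite scaler0 add0r.
Qed.

Lemma derivable_line phi i p :
  derivable phi p (basis_vec i) <-> derivable (phi \o line i p) (coord i p) 1.
Proof. by rewrite /derivable quotient_line. Qed.

Lemma partial_line phi i p : partial i phi p = 'D_1 (phi \o line i p) (coord i p).
Proof. by rewrite /partial /derive quotient_line. Qed.

Lemma is_derive_line phi i p d :
  is_derive p (basis_vec i) phi d <-> is_derive (coord i p) 1 (phi \o line i p) d.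
Proof.
split => -[D E]; split.
- exact/derivable_line.
- by rewrite -partial_line.
- exact/derivable_line.
- by rewrite -[LHS]/(partial i phi p) partial_line.
Qed.
End Lines.

(** * Smoothness through classes stable under derivation *)

Section SmoothClasses.
Context {R : realType}.
Implicit Types (f g h phi : R * R -> R) (i : 'I_2) (S : set (R * R -> R)).

(** A coinduction principle: to prove [f] smooth it suffices to exhibit a class containing [f], with
    no formula for its iterated derivatives. *)
Definition smooth_class S := forall g, S g -> continuous g /\
  forall i, exists2 g', S g' & forall x, is_derive x (basis_vec i) g (g' x).

Lemma smooth_of_class S f : smooth_class S -> S f -> smooth f.
Proof.
move=> cS Sf; have Ss s : S (iter_partial s f).
  elim: s => //= i s /cS[_ /(_ i)[g' Sg' dg']].
  suff -> : partial i (iter_partial s f) = g' by [].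
  by apply/funext => x; case: (dg' x).
move=> s; have [cf df] := cS _ (Ss s); split => // i x.
by have [g' _ dg'] := df i; have [] := dg' x.
Qed.

Lemma smooth_is_derive f (s : seq 'I_2) i x : smooth f ->
  is_derive x (basis_vec i) (iter_partial s f) (iter_partial (i :: s) f x).
Proof. by move=> /(_ s)[_ df]; apply: DeriveDef. Qed.

Lemma smooth_continuous f (s : seq 'I_2) : smooth f -> continuous (iter_partial s f).
Proof. by move=> /(_ s)[]. Qed.

Lemma smooth0 : smooth (cst 0 : R * R -> R).
Proof.
apply: (@smooth_of_class [set cst 0]) => // _ ->; split; first exact: cst_continuous.
by move=> i; exists (cst 0) => // x; exact: is_derive_cst.
Qed.

Lemma smoothZD c f g : smooth f -> smooth g -> smooth (c *: f + g).
Proof.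
move=> sf sg.
apply: (@smooth_of_class [set h | exists s, h = c *: iter_partial s f + iter_partial s g]);
  last by exists [::].
move=> _ [s ->]; split=> [x|i].
  apply: continuousD; last exact: smooth_continuous.
  by apply: continuousZr; exact: smooth_continuous.
exists (c *: iter_partial (i :: s) f + iter_partial (i :: s) g); first by exists (i :: s).
move=> x; apply: is_deriveD; last exact: smooth_is_derive.
by apply: is_deriveZ; exact: smooth_is_derive.
Qed.

(** The class consists of finite sums of products of iterated derivatives of [f] and [g]; the
    Leibniz rule replaces each term by two. *)
Lemma smoothM f g : smooth f -> smooth g -> smooth (f * g).
Proof.
move=> sf sg; pose T (p : seq 'I_2 * seq 'I_2) := iter_partial p.1 f * iter_partial p.2 g.
pose sums (l : seq (seq 'I_2 * seq 'I_2)) := \sum_(p <- l) T p.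
apply: (@smooth_of_class [set sums l | l in setT]); last first.
  by exists [:: ([::], [::])] => //; rewrite /sums big_seq1.
move=> _ [l _ <-]; split.
  elim: l => [|p l ih]; rewrite /sums ?big_nil ?big_cons; first exact: cst_continuous.
  move=> x; apply: continuousD; last exact: ih.
  by apply: continuousM; exact: smooth_continuous.
move=> i; elim: l => [|p l [_ [l' _ <-] ih]].
  exists (cst 0); first by exists [::] => //; rewrite /sums big_nil.
  by move=> x; rewrite /sums big_nil; exact: is_derive_cst.
exists (sums [:: (p.1, i :: p.2), (i :: p.1, p.2) & l']).
  by exists [:: (p.1, i :: p.2), (i :: p.1, p.2) & l'].
move=> x; rewrite /sums !big_cons addrA; apply: is_deriveD => //.
apply: (is_derive_eq (is_deriveM (smooth_is_derive p.1 i x sf) (smooth_is_derive p.2 i x sg))).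
by rewrite /GRing.scale/= [X in _ + X]mulrC.
Qed.

Lemma coord_continuous i : continuous (coord i : R * R -> R).
Proof. by move=> x; rewrite /coord; case: (i == ord0); [exact: cvg_fst|exact: cvg_snd]. Qed.

Lemma coord_line_neq i j x s : i != j -> coord i (line j x s) = coord i x :> R.
Proof.
rewrite /coord /line; have [->|i0] := eqVneq i ord0; first by rewrite eq_sym => /negPf ->.
have [//|j0] := eqVneq j ord0; case: i j i0 j0 => [[|[|//]] hi] [[|[|//]] hj] // _ _.
Qed.

(** The class has an extra scalar [k]: it absorbs the factor [l] of the chain rule, and [k = 0]
    covers the derivative in the other direction. *)
Lemma smooth_flat (c : R) (P : {poly R}) i (l b : R) : 0 < c ->
  smooth (fun x => flat c P (l * coord i x + b)).
Proof.
move=> c0.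
apply: (@smooth_of_class [set h | exists k Q, h = fun x => k * flat c Q (l * coord i x + b)]);
  last by exists 1, P; apply/funext => x; rewrite mul1r.
move=> _ [k [Q ->]]; split.
  have cF : continuous (flat c Q).
    move=> s; apply/differentiable_continuous/derivable1_diffP.
    by have [] := is_derive_flat c0 Q s.
  have cl : continuous (fun x => l * coord i x + b).
    move=> x; apply: cvgD; last exact: cvg_cst.
    by apply: cvgM; [exact: cvg_cst|exact: coord_continuous].
  move=> x; apply: cvgM; first exact: cvg_cst.
  exact: cvg_comp (cl x) (cF _).
move=> j; have [->|ij] := eqVneq j i.
  exists (fun x => (k * l) * flat c ('X^2 * (c *: Q - Q^`())) (l * coord i x + b)).
    by exists (k * l), ('X^2 * (c *: Q - Q^`())).
  move=> x; apply/is_derive_line.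
  have dl : is_derive (coord i x) 1 (fun s => l * s + b) l.
    by apply: is_derive_eq; rewrite ?addr0 /GRing.scale/= ?mulr1.
  have := is_deriveZ k (@is_derive1_comp _ (flat c Q) (fun s => l * s + b) _ _ _
    (is_derive_flat c0 Q (l * coord i x + b)) dl).
  rewrite (_ : _ \*: _ = (fun x => k * flat c Q (l * coord i x + b)) \o line i x); last first.
    by apply/funext => s /=; rewrite coord_line.
  by move=> d; apply: is_derive_eq d _; rewrite /GRing.scale/=; ring.
exists (cst 0); first by exists 0, 0; apply/funext => x; rewrite mul0r.
move=> x; apply/is_derive_line.
rewrite (_ : _ \o _ = cst (k * flat c Q (l * coord i x + b))); first exact: is_derive_cst.
apply/funext => s /=; congr (_ * flat _ _ (_ * _ + _)).
by rewrite coord_line_neq// eq_sym.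
Qed.
End SmoothClasses.

(** * Bumps converging to the indicator of a box *)

Section Bump.
Context {R : realType}.
Implicit Types (a b x : R * R) (n : nat).

Let c n : R := n.+1%:R^-1.
Let c0 n : 0 < c n. Proof. by rewrite invr_gt0. Qed.

Definition bump_factor n i a b x : R :=
  flat (c n) 1 (1 * coord i x - coord i a) * flat (c n) 1 (-1 * coord i x + coord i b).

Definition bump n a b : R * R -> R := bump_factor n ord0 a b * bump_factor n ord_max a b.

Let flat01 n s : 0 <= flat (c n) 1 s <= 1.
Proof.
rewrite /flat; case: ifPn => s0; last by rewrite lexx ler01.
by rewrite hornerC mul1r expR_ge0/= expR_le1 oppr_le0 divr_ge0// ltW.
Qed.

Let factor01 n i a b x : 0 <= bump_factor n i a b x <= 1.
Proof.
have /andP[? ?] := flat01 n (1 * coord i x - coord i a).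
have /andP[? ?] := flat01 n (-1 * coord i x + coord i b).
by rewrite /bump_factor mulr_ge0//= mulr_ile1.
Qed.

Lemma bump01 n a b x : 0 <= bump n a b x <= 1.
Proof.
have /andP[? ?] := factor01 n ord0 a b x.
have /andP[? ?] := factor01 n ord_max a b x.
by rewrite /bump mulr_ge0//= mulr_ile1.
Qed.

Let flat_gt0 n s : flat (c n) 1 s != 0 -> 0 < s.
Proof. by rewrite /flat; case: ifP => //; rewrite eqxx. Qed.

Lemma bump_support n a b x : bump n a b x != 0 -> open_box a b x.
Proof.
rewrite /bump /bump_factor !mulf_eq0 !negb_or => /andP[/andP[]].
move=> /flat_gt0 + /flat_gt0 + /andP[/flat_gt0 + /flat_gt0].
rewrite /coord /= => *; rewrite /open_box /=; split; rewrite /= in_itv/=; lra.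
Qed.

Let flat_cvg s : 0 < s -> flat (c n) 1 s @[n --> \oo] --> (1 : R).
Proof.
move=> s0; rewrite (_ : (fun n => _) = (fun n => expR (- (c n / s)))); last first.
  by apply/funext => n; rewrite /flat s0 hornerC mul1r.
rewrite -expR0 -[0]oppr0 -(mul0r s^-1).
have h : - (c n / s) @[n --> \oo] --> - (0 / s).
  by apply: cvgN; apply: cvgM; [exact: cvg_harmonic|exact: cvg_cst].
exact: cvg_comp h (@continuous_expR _ _).
Qed.

Lemma bump_cvg a b x : open_box a b x -> bump n a b x @[n --> \oo] --> (1 : R).
Proof.
move=> [/= +]; rewrite !in_itv/= => /andP[ax xb] /andP[ay yb].
have F i : coord i a < coord i x -> coord i x < coord i b ->
    bump_factor n i a b x @[n --> \oo] --> (1 : R).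
  move=> *; rewrite -[X in _ --> X]mulr1.
  by apply: cvgM; apply: flat_cvg; lra.
by rewrite -[X in _ --> X]mulr1; apply: cvgM; exact: F.
Qed.

Lemma smooth_bump n a b : smooth (bump n a b).
Proof. by apply: smoothM; apply: smoothM; exact: smooth_flat. Qed.

Lemma test_bump (Omega : set (R * R)) n a b : closed_box a b `<=` Omega ->
  test_function Omega (bump n a b).
Proof.
move=> abO; have cK : compact (closed_box a b).
  by apply: compact_setX; exact: segment_compact.
have sub : closure [set x | bump n a b x != 0] `<=` closed_box a b.
  rewrite closureE => x; apply; split.
    exact: compact_closed.
  move=> y /= /bump_support[]; rewrite /= !in_itv/= => /andP[? ?] /andP[? ?].
  by split; rewrite /= in_itv/= !ltW.
split; [exact: smooth_bump| |exact: subset_trans sub abO].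
by apply: subclosed_compact sub => //; exact: closed_closure.
Qed.

End Bump.

(** * The du Bois-Reymond lemma *)

Section DuBoisReymond.
Context {R : realType} (Omega : set (R * R)).
Local Notation plane := (measurableTypeR R * measurableTypeR R)%type.
Hypothesis oO : open Omega.
Hypothesis bO : bounded_set Omega.
Local Notation mu := (lebesgue2 R).
Local Notation ip := (L2_inner Omega).
Let mO : measurable (Omega : set plane) := open_measurable2 oO.

Lemma bounded_in_box : exists2 M : R, 0 < M & Omega `<=` closed_box (- M, - M) (M, M).
Proof.
have [M [_ MP]] := bO; pose N := Num.max M 0 + 1.
have N0 : 0 < N by rewrite ltr_pwDr// le_max lexx orbT.
have MN : M < N by rewrite ltr_pwDr// le_max lexx.
exists N => // x /(MP N MN); rewrite /= prod_normE ge_max !ler_norml => /andP[].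
by move=> ? ?; split; rewrite /= in_itv.
Qed.

Lemma finite_measure : (mu Omega < +oo)%E.
Proof.
have [M M0 MO] := bounded_in_box.
apply: (@le_lt_trans _ _ (mu (closed_box (- M, - M) (M, M)))).
  by apply: le_measure => //; rewrite inE//; apply: measurableX; exact: measurable_itv.
rewrite product_measure1E; try exact: measurable_itv.
rewrite /= !lebesgue_measure_itv/= !lte_fin.
by case: ifP => _; rewrite ?mul0e// -?EFinD -?EFinM ?ltry.
Qed.

Lemma L2_bounded (v : R * R -> R) (M : R) : measurable_fun (Omega : set plane) v ->
  (forall x, Omega x -> `|v x| <= M) -> L2 Omega v.
Proof.
move=> mv vM; apply/(L2P mO); split => //.
apply: (@le_lt_trans _ _ (\int[mu]_(x in Omega) (M ^+ 2)%:E)%E).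
  apply: ge0_le_integral => //=.
  - by move=> x _; rewrite lee_fin sqr_ge0.
  - by apply/measurable_EFinP; exact: measurable_funX.
  - move=> x /vM vx; rewrite lee_fin -[v x ^+ 2]real_normK ?num_real//.
    by rewrite lerXn2r ?nnegrE// (le_trans _ vx).
rewrite integral_cst//; apply: lte_mul_pinfty => //; first by rewrite lee_fin sqr_ge0.
exact: finite_measure.
Qed.

Variable g : R * R -> R.
Hypothesis Lg : L2 Omega g.
Hypothesis g_test : forall phi, test_function Omega phi -> ip g phi = 0.

(** Dominated convergence along the bumps of the box, each orthogonal to [g]. The bound [|g|] is
    integrable because [Omega] has finite measure. *)
Lemma integral_open_box a b : closed_box a b `<=` Omega ->
  (\int[mu]_(x in open_box a b) (g x)%:E = 0)%E.
Proof.
move=> abO; have BO := subset_trans (@open_box_closed _ a b) abO.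
have mB : measurable (open_box a b : set plane) by exact: open_box_measurable.
have L1 : L2 Omega (cst 1) by apply: (@L2_bounded _ 1) => // x _; rewrite normr1.
have mg := L2_measurable mO Lg.
have mbump n : measurable_fun (Omega : set plane) (bump n a b).
  apply: (measurable_funS (@measurableT _ plane)) => //.
  have cb : continuous (bump n a b) by case: (smooth_bump n a b [::]).
  exact: (continuous_measurable_fun2 cb).
have [] := @dominated_convergence _ plane R mu Omega mO
  (fun n x => (g x * bump n a b x)%:E) (fun x => (g x * \1_(open_box a b) x)%:E)
  (fun x => `|(g x * 1)%:E|)%E.
- by move=> n; apply/measurable_EFinP; exact: measurable_funM.
- by apply/measurable_EFinP; apply: measurable_funM => //; exact: measurable_indic.
- apply: aeW => x Ox; apply: cvg_EFin; first exact: nearW.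
  apply: cvgM; first exact: cvg_cst.
  rewrite indicE; have [|xB] := boolP (x \in open_box a b).
    by rewrite inE => /bump_cvg.
  rewrite (_ : (fun n => _) = cst 0); first exact: cvg_cst.
  apply/funext => n; apply/eqP; apply: contraNT xB => /bump_support.
  by rewrite inE.
- by apply: integrable_abse; exact: (L2_integrable_mul mO Lg L1).
- apply: aeW => x n _; rewrite mulr1 lee_fin normrM ler_piMr//.
  by have /andP[? ?] := bump01 n a b x; rewrite ger0_norm.
move=> _ _; have -> : [sequence (\int[mu]_(x in Omega) (g x * bump n a b x)%:E)%E]_n = cst 0%E.
  apply/funext => n /=.
  have Lb : L2 Omega (bump n a b).
    apply: (@L2_bounded _ 1) => // x _.
    by have /andP[? ?] := bump01 n a b x; rewrite ger0_norm.
  have := g_test (test_bump n abO); rewrite /L2_inner /Rintegral => e.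
  rewrite -[LHS]fineK ?e//; apply: integrable_fin_num => //.
  exact: (L2_integrable_mul mO Lg Lb).
have -> : (\int[mu]_(x in open_box a b) (g x)%:E =
    \int[mu]_(x in Omega) (g x * \1_(open_box a b) x)%:E)%E.
  rewrite integral_mkcond [RHS]integral_mkcond; apply: eq_integral => x _.
  rewrite !patchE indicE; case: (boolP (x \in open_box a b)) => xB.
    by rewrite mulr1 mem_set//; apply: BO; rewrite inE in xB.
  by rewrite mulr0; case: ifP.
by move=> h; exact: (cvg_unique _ h (@cvg_cst _ _ _ _ _)).
Qed.

(** The sets [A] for which [g] has integral [0] over the part of [A] in the box form a Dynkin class
    containing the open boxes, hence contain all measurable sets. An integrable function with
    vanishing integrals is null. *)
Lemma ae_eq0_open_box a b : closed_box a b `<=` Omega ->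
  {ae mu, forall x, open_box a b x -> g x = 0}.
Proof.
move=> abO; have BO := subset_trans (@open_box_closed _ a b) abO.
set B := open_box a b.
have mB : measurable (B : set plane) by exact: open_box_measurable.
have L1 : L2 Omega (cst 1) by apply: (@L2_bounded _ 1) => // x _; rewrite normr1.
have ig : mu.-integrable B (EFin \o g).
  have := integrableS mO mB BO (L2_integrable_mul mO Lg L1).
  by apply: eq_integrable => // x _; rewrite /= mulr1.
have igI (A : set plane) : measurable A -> mu.-integrable (A `&` B) (EFin \o g).
  by move=> mA; apply: integrableS ig => //; exact: measurableI.
pose P (A : set plane) := (\int[mu]_(x in A `&` B) (g x)%:E = 0)%E.
have PA : forall A, <<s open_boxes >> A -> P A.
  apply: (@dynkin_induction _ plane) => [||||A mA PA|F mF tF PF].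
  - exact: plane_measurableE.
  - exact: open_boxes_setI.
  - by rewrite /P setTI; exact: integral_open_box.
  - move=> _ [c [d ->]]; rewrite /P /B.
    rewrite open_boxI; apply: integral_open_box; apply: subset_trans abO.
    move=> x [/=]; rewrite !in_itv/= !ge_max !le_min.
    move=> /andP[/andP[_ ?] /andP[_ ?]] /andP[/andP[_ ?] /andP[_ ?]].
    by split; rewrite /= in_itv/=; apply/andP.
  - have mI : measurable (A `&` B) by exact: measurableI.
    have mCI : measurable (~` A `&` B) by apply: measurableI => //; exact: measurableC.
    have := integral_open_box abO; rewrite -/B -{1}(setTI B) -(setUv A) setIUl.
    rewrite integral_setU//; last 2 first.
    + by rewrite -setIUl setUv setTI; case/integrableP : ig.
    + by apply/disj_set2P; rewrite setIACA setICr set0I.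
    by rewrite PA add0e.
  - rewrite /P setI_bigcupl integral_bigcup.
    + by rewrite (eq_eseriesr (fun k _ => PF k)) eseries0.
    + exact: trivIset_setIr.
    + by move=> k; exact: measurableI.
    + by rewrite -setI_bigcupl; apply: igI; exact: bigcupT_measurable.
have : ae_eq mu B (EFin \o g) (cst 0%E).
  apply: integral_ae_eq => // E EB mE.
  rewrite integral0 -(setIidl EB); apply: PA.
  by rewrite -plane_measurableE.
by apply: ae_imply => x /[apply] /= -[].
Qed.

Lemma ae_eq0_of_test : {ae mu, forall x, Omega x -> g x = 0}.
Proof.
(* Rational boxes are enumerated by their codes, so that countably many null sets are combined;
   integers that are not codes carry no condition. *)
pose P k x := if unpickle k is Some q then
  closed_box (rational_lo q) (rational_hi q) `<=` Omega ->
  open_box (rational_lo q) (rational_hi q) x -> g x = 0 else True.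
have : {ae mu, forall x, forall k, P k x}.
  apply: ae_foralln => k; rewrite /P; case: unpickle => [q|]; last exact: aeW.
  have [qO|qO] := pselect (closed_box (rational_lo q) (rational_hi q) `<=` Omega).
    by apply: ae_imply (ae_eq0_open_box qO).
  by apply: aeW.
apply: ae_imply => x Px Ox; have [q [Bx qO]] := open_rational_box oO Ox.
by have := Px (pickle q); rewrite /P pickleK; exact.
Qed.
End DuBoisReymond.

(** * Integration by parts *)

Section TestFunctions.
Context {R : realType} (Omega : set (R * R)).
Local Notation plane := (measurableTypeR R * measurableTypeR R)%type.
Hypothesis oO : open Omega.
Hypothesis bO : bounded_set Omega.
Local Notation mu := (lebesgue2 R).
Local Notation ip := (L2_inner Omega).
Let mO : measurable (Omega : set plane) := open_measurable2 oO.
Implicit Types (phi psi k : R * R -> R) (i : 'I_2).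

Lemma test_functionP phi : test_function Omega phi <->
  smooth phi /\ closure [set x | phi x != 0] `<=` Omega.
Proof.
split=> [[]//|[sphi sub]]; split=> //; have [M _ MO] := bounded_in_box bO.
apply: subclosed_compact (subset_trans sub MO); first exact: closed_closure.
by apply: compact_setX; exact: segment_compact.
Qed.

Lemma test_function_out phi x : test_function Omega phi -> ~ Omega x -> phi x = 0.
Proof.
move=> [_ _ sub] xO; apply/eqP; apply: contrapT => /negP phix; apply: xO.
by apply: sub; exact: subset_closure.
Qed.

Lemma test_function0 : test_function Omega (cst 0).
Proof.
apply/test_functionP; split; first exact: smooth0.
rewrite (_ : [set x | _] = set0) ?closure0//.
by apply/seteqP; split => x //=; rewrite eqxx.
Qed.

Lemma test_functionZD c phi psi : test_function Omega phi -> test_function Omega psi ->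
  test_function Omega (c *: phi + psi).
Proof.
move=> /test_functionP[s1 c1] /test_functionP[s2 c2]; apply/test_functionP.
split; first exact: smoothZD.
apply: (@subset_trans _ (closure ([set x | phi x != 0] `|` [set x | psi x != 0]))).
  apply: closure_subset => x /=; apply: contraPP => /not_orP[].
  move=> /negP; rewrite negbK => /eqP e1 /negP; rewrite negbK => /eqP e2.
  by rewrite !fctE e1 e2 scaler0 addr0 eqxx.
by rewrite closureU subUset.
Qed.

Lemma test_function_partial i phi : test_function Omega phi ->
  test_function Omega (partial i phi).
Proof.
move=> /test_functionP[sphi cphi]; apply/test_functionP; split.
  by move=> s; rewrite /iter_partial -foldr_rcons; exact: sphi.
apply: subset_trans cphi; rewrite [X in X `<=` _]closureE => y; apply; split.
  exact: closed_closure.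
move=> {y} x /=; apply: contraPP => xc.
have /near_eq_derive : \forall y \near x, phi y = cst 0 y.
  have : open_nbhs x (~` closure [set x | phi x != 0]).
    by split => //; apply: closed_openC; exact: closed_closure.
  move=> /open_nbhs_nbhs; apply: filterS => y yc.
  apply/eqP; apply: contrapT => /negP phiy; apply: yc.
  exact: subset_closure.
by rewrite /partial => ->; rewrite derive_cst eqxx.
Qed.

Lemma test_continuous phi : test_function Omega phi -> continuous phi.
Proof. by case=> /(_ [::])[]. Qed.

Lemma test_is_derive phi i x : test_function Omega phi ->
  is_derive x (basis_vec i) phi (partial i phi x).
Proof. by case=> sphi _ _; exact: (smooth_is_derive [::]). Qed.

Lemma L2_continuous k : continuous k -> L2 Omega k.
Proof.
move=> ck; have [M _ MO] := bounded_in_box bO.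
have cK : compact (closed_box (- M, - M) (M, M)).
  by apply: compact_setX; exact: segment_compact.
have /compact_bounded[N [_ NP]] := continuous_compact (continuous_subspaceT ck) cK.
apply: (@L2_bounded _ _ oO bO _ (N + 1)).
  by apply: measurable_funS (continuous_measurable_fun2 ck).
by move=> x /MO xM; apply: (NP (N + 1)); [rewrite ltrDl|exists x].
Qed.

Lemma L2_test phi : test_function Omega phi -> L2 Omega phi.
Proof. by move=> /test_continuous; exact: L2_continuous. Qed.

Lemma line_continuous i (x : R * R) : continuous (line i x).
Proof.
move=> s; apply/cvgrPdist_lt => e e0; near=> t.
have st : `|s - t| < e by near: t; exists e.
by rewrite /line; case: (i == ord0); rewrite prod_normE /= subrr normr0 gt_max st e0.
Unshelve. all: by end_near. Qed.

Lemma line_in_box i x (M s : R) : closed_box (- M, - M) (M, M) (line i x s) -> - M <= s <= M.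
Proof. by rewrite /line; case: (i == ord0) => -[/=]; rewrite !in_itv. Qed.

Let integral_line i k k' x : continuous k -> continuous k' ->
  (forall x, is_derive x (basis_vec i) k (k' x)) ->
  (forall x, ~ Omega x -> k x = 0) -> (forall x, ~ Omega x -> k' x = 0) ->
  (\int[lebesgue_measure]_s (k' (line i x s))%:E = 0)%E.
Proof.
move=> ck ck' dk k0 k'0; have [M M0 MO] := bounded_in_box bO.
have out (s : R) : ~ (- M <= s <= M) -> ~ Omega (line i x s).
  by move=> sM /MO /line_in_box.
have dl (s : R) : is_derive s 1 (k \o line i x) (k' (line i x s)).
  have /is_derive_line := dk (line i x s); rewrite coord_line.
  rewrite (_ : k \o line i (line i x s) = k \o line i x)//.
  by apply/funext => t /=; rewrite line_line.
have cl : continuous (k \o line i x).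
  by move=> s; apply: continuous_comp; [exact: line_continuous|exact: ck].
(* The closed box of half side [M] may reach its own boundary inside [Omega]; the margin [1] puts
   both endpoints where [k] vanishes. *)
pose N := M + 1.
have := @continuous_FTC2 R (k' \o line i x) (k \o line i x) (- N) N.
rewrite /= (k0 (line i x N)); last by apply: out; rewrite /N; lra.
rewrite (k0 (line i x (- N))); last by apply: out; rewrite /N; lra.
rewrite -EFinD subrr => FTC.
transitivity (\int[lebesgue_measure]_(s in `[(- N)%R, N]) (k' (line i x s))%:E)%E.
  rewrite [RHS]integral_mkcond; apply: eq_integral => s _; rewrite patchE.
  case: ifPn => //; rewrite notin_setE /= in_itv/= => sN.
  by rewrite k'0//; apply: out => sM; apply: sN; rewrite /N; lra.
apply: FTC.
- by rewrite /N; lra.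
- apply: continuous_subspaceT => s.
  by apply: continuous_comp; [exact: line_continuous|exact: ck'].
- split => [s _| |].
  + by have [] := dl s.
  + by apply: cvg_at_right_filter; exact: cl.
  + by apply: cvg_at_left_filter; exact: cl.
- by move=> s _; rewrite derive1E; have [] := dl s.
Qed.

(** As [k'] vanishes off [Omega], the integral extends to the plane; Fubini then integrates first in
    the direction [i]. *)
Let integral_partial i k k' : continuous k -> continuous k' ->
  (forall x, is_derive x (basis_vec i) k (k' x)) ->
  (forall x, ~ Omega x -> k x = 0) -> (forall x, ~ Omega x -> k' x = 0) ->
  \int[mu]_(x in Omega) k' x = 0.
Proof.
move=> ck ck' dk k0 k'0.
have e : (fun x => (k' x)%:E) = (fun x => (k' x)%:E) \_ Omega.
  apply/funext => x; rewrite patchE; case: ifPn => //.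
  by rewrite notin_setE => /k'0 ->.
have L1 : L2 Omega (cst 1) by apply: L2_continuous; exact: cst_continuous.
have ik' : mu.-integrable setT (fun x => (k' x)%:E).
  rewrite e; apply/(integrable_mkcond _ mO).
  have := L2_integrable_mul mO (L2_continuous ck') L1.
  by apply: eq_integrable => // x _; rewrite /= mulr1.
rewrite /Rintegral integral_mkcond -e; have [i0|i0] := eqVneq i ord0.
  rewrite -(integral21_prod_meas1 ik') integral0_eq// => y _.
  have := @integral_line i k k' (0, y) ck ck' dk k0 k'0.
  by rewrite /fubini_G /line i0.
rewrite -(integral12_prod_meas1 ik') integral0_eq// => y _.
have := @integral_line i k k' (y, 0) ck ck' dk k0 k'0.
by rewrite /fubini_F /line (negPf i0).
Qed.

(** The product [k phi] vanishes off [Omega], so its derivative has integral [0]. Besides test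
    functions, [k] will be [x_1 phi] in the Poincare inequality. *)
Lemma classical_weak_partial i k k' : continuous k -> continuous k' ->
  (forall x, is_derive x (basis_vec i) k (k' x)) -> weak_partial Omega i k k'.
Proof.
move=> ck ck' dk phi tphi.
have tp := test_function_partial i tphi.
have cphi := test_continuous tphi; have cp := test_continuous tp.
have Lk := L2_continuous ck; have Lk' := L2_continuous ck'.
apply/eqP; rewrite -addr_eq0 /L2_inner -RintegralD//; last 2 first.
- exact: (L2_integrable_mul mO Lk (L2_test tp)).
- exact: (L2_integrable_mul mO Lk' (L2_test tphi)).
apply/eqP; apply: (@integral_partial i (k * phi)).
- by move=> x; apply: continuousM; [exact: ck|exact: cphi].
- move=> x; apply: cvgD; apply: cvgM; [exact: ck|exact: cp|exact: ck'|exact: cphi].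
- move=> x; apply: (is_derive_eq (is_deriveM (dk x) (test_is_derive i x tphi))).
  by rewrite /GRing.scale/= [X in _ + X]mulrC.
- by move=> x xO; rewrite !fctE (test_function_out tphi xO) mulr0.
- by move=> x xO; rewrite (test_function_out tphi xO) (test_function_out tp xO) !mulr0 addr0.
Qed.

Lemma test_weak_partial i phi : test_function Omega phi ->
  weak_partial Omega i phi (partial i phi).
Proof.
move=> tphi; apply: classical_weak_partial.
- exact: test_continuous.
- by apply: test_continuous; exact: test_function_partial.
- by move=> x; exact: test_is_derive.
Qed.
End TestFunctions.

(** * Sobolev spaces *)

Section SobolevSpaces.
Context {R : realType} (Omega : set (R * R)).
Local Notation plane := (measurableTypeR R * measurableTypeR R)%type.
Hypothesis oO : open Omega.
Hypothesis bO : bounded_set Omega.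
Local Notation mu := (lebesgue2 R).
Local Notation ip := (L2_inner Omega).
Let mO : measurable (Omega : set plane) := open_measurable2 oO.
Implicit Types (phi psi v w g z : R * R -> R) (i : 'I_2) (c : R).
Local Notation "v =ae w" := {ae mu, forall x, Omega x -> v x = w x} (at level 70).

Let L2m v : L2 Omega v -> measurable_fun (Omega : set plane) v.
Proof. exact: (L2_measurable mO). Qed.

Let L2D c v w : L2 Omega v -> L2 Omega w -> L2 Omega (c *: v + w).
Proof. exact: L2ZD. Qed.

Let L2t phi : test_function Omega phi -> L2 Omega phi.
Proof. exact: L2_test. Qed.

Let tpartial i phi : test_function Omega phi -> test_function Omega (partial i phi).
Proof. exact: test_function_partial. Qed.

Lemma L2B v w : L2 Omega v -> L2 Omega w -> L2 Omega (v - w).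
Proof. by move=> Lv Lw; rewrite addrC -scaleN1r; exact: L2D. Qed.

Lemma L2_inner_linearr c v w z : L2 Omega v -> L2 Omega w -> L2 Omega z ->
  ip z (c *: v + w) = c * ip z v + ip z w.
Proof. by move=> Lv Lw Lz; rewrite ![ip z _]L2_innerC L2_inner_linear. Qed.

Lemma L2_innerBl v w z : L2 Omega v -> L2 Omega w -> L2 Omega z ->
  ip (v - w) z = ip v z - ip w z.
Proof.
by move=> Lv Lw Lz; rewrite addrC -scaleN1r L2_inner_linear// mulN1r addrC.
Qed.

Lemma ae_L2_inner2 v v' w w' : L2 Omega v -> L2 Omega v' -> L2 Omega w -> L2 Omega w' ->
  v =ae v' -> w =ae w' -> ip v w = ip v' w'.
Proof.
move=> Lv Lv' Lw Lw' vv' ww'.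
rewrite (ae_L2_inner mO (L2m Lv) (L2m Lv') (L2m Lw) vv') L2_innerC.
by rewrite (ae_L2_inner mO (L2m Lw) (L2m Lw') (L2m Lv') ww') L2_innerC.
Qed.

Lemma ae_eq_of_test g h : L2 Omega g -> L2 Omega h ->
  (forall phi, test_function Omega phi -> ip g phi = ip h phi) -> g =ae h.
Proof.
move=> Lg Lh gh; have := @ae_eq0_of_test _ _ oO bO _ (L2B Lg Lh).
have e phi : test_function Omega phi -> ip (g - h) phi = 0.
  by move=> tphi; rewrite L2_innerBl ?gh ?subrr//; exact: L2t.
by move=> /(_ e); apply: ae_imply => x /[apply] /eqP; rewrite subr_eq0 => /eqP.
Qed.

Lemma weak_partialZD i c v w g h : L2 Omega v -> L2 Omega w -> L2 Omega g -> L2 Omega h ->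
  weak_partial Omega i v g -> weak_partial Omega i w h ->
  weak_partial Omega i (c *: v + w) (c *: g + h).
Proof.
move=> Lv Lw Lg Lh vg wh phi tphi.
have Lp := L2t tphi.
have Lpp := L2t (tpartial i tphi).
by rewrite !L2_inner_linear// vg// wh// opprD mulrN.
Qed.

Lemma wpartialP i v : H1 Omega v ->
  L2 Omega (wpartial Omega i v) /\ weak_partial Omega i v (wpartial Omega i v).
Proof.
move=> [_ /(_ i)[g Lg vg]].
exact: (@xgetPex _ (cst 0) [set g | L2 Omega g /\ weak_partial Omega i v g]
  (ex_intro _ g (conj Lg vg))).
Qed.

Lemma wpartial_ae i v g : H1 Omega v -> L2 Omega g -> weak_partial Omega i v g ->
  wpartial Omega i v =ae g.
Proof.
move=> Hv Lg vg; have [Lw vw] := wpartialP i Hv; apply: ae_eq_of_test => // phi tphi.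
by apply: oppr_inj; rewrite -vg// vw.
Qed.

Lemma H1ZD c v w : H1 Omega v -> H1 Omega w -> H1 Omega (c *: v + w).
Proof.
move=> Hv Hw; split; first by apply: L2D; [case: Hv|case: Hw].
move=> i; have [Lv vp] := wpartialP i Hv; have [Lw wp] := wpartialP i Hw.
exists (c *: wpartial Omega i v + wpartial Omega i w); first exact: L2D.
by apply: weak_partialZD => //; [case: Hv|case: Hw].
Qed.

Lemma wpartialZD i c v w : H1 Omega v -> H1 Omega w ->
  wpartial Omega i (c *: v + w) =ae c *: wpartial Omega i v + wpartial Omega i w.
Proof.
move=> Hv Hw; have [Lv vp] := wpartialP i Hv; have [Lw wp] := wpartialP i Hw.
apply: wpartial_ae; [exact: H1ZD|exact: L2D|].
by apply: weak_partialZD => //; [case: Hv|case: Hw].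
Qed.

Lemma H1_test phi : test_function Omega phi -> H1 Omega phi.
Proof.
move=> tphi; split; first exact: L2t.
move=> i; exists (partial i phi); last exact: test_weak_partial.
exact/L2t/tpartial.
Qed.

Lemma grad_inner_linear c v w z : H1 Omega v -> H1 Omega w -> H1 Omega z ->
  grad_inner Omega (c *: v + w) z = c * grad_inner Omega v z + grad_inner Omega w z.
Proof.
move=> Hv Hw Hz; rewrite /grad_inner mulr_sumr -big_split; apply: eq_bigr => i _ /=.
have [Lv _] := wpartialP i Hv; have [Lw _] := wpartialP i Hw; have [Lz _] := wpartialP i Hz.
rewrite -L2_inner_linear//; apply: (ae_L2_inner2 _ _ Lz Lz).
- by have [] := wpartialP i (H1ZD c Hv Hw).
- exact: L2D.
- exact: wpartialZD.
- exact: aeW.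
Qed.

Lemma grad_innerC v w : grad_inner Omega v w = grad_inner Omega w v.
Proof. by apply: eq_bigr => i _; rewrite L2_innerC. Qed.

Lemma grad_inner_ge0 v : 0 <= grad_inner Omega v v.
Proof. by apply: sumr_ge0 => i _; exact: L2_inner_ge0. Qed.

(** Lets the energy be computed from weak derivatives obtained as [L^2] limits, in place of the
    chosen representatives. *)
Lemma grad_inner_ae v (g : 'I_2 -> R * R -> R) : H1 Omega v -> (forall i, L2 Omega (g i)) ->
  (forall i, weak_partial Omega i v (g i)) ->
  grad_inner Omega v v = \sum_(i < 2) ip (g i) (g i).
Proof.
move=> Hv Lg vg; apply: eq_bigr => i _; have [Lv _] := wpartialP i Hv.
by apply: ae_L2_inner2 => //; apply: wpartial_ae.
Qed.

(** Density arguments use the squared norm, with the parallelogram law in the role of the triangle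
    inequality. *)
Let H1_sqr v : R := ip v v + grad_inner Omega v v.

Let H1_sqr_ge0 v : 0 <= H1_sqr v.
Proof. by rewrite addr_ge0 ?grad_inner_ge0// L2_inner_ge0. Qed.

Let H1_norm_lt v eps : 0 < eps -> (H1_norm Omega v < eps) = (H1_sqr v < eps ^+ 2).
Proof.
move=> e0; rewrite -[in LHS](ger0_norm (ltW e0)) -sqrtr_sqr /H1_norm -/(H1_sqr v).
by rewrite ltr_sqrt// exprn_gt0.
Qed.

Let H1_sqrZD c v w : H1 Omega v -> H1 Omega w ->
  H1_sqr (c *: v + w) <= 2 * c ^+ 2 * H1_sqr v + 2 * H1_sqr w.
Proof.
move=> Hv Hw.
have e (d : R) : H1_sqr (d *: v + w) =
    d ^+ 2 * H1_sqr v + 2 * d * (ip v w + grad_inner Omega v w) + H1_sqr w.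
  have Lv := Hv.1; have Lw := Hw.1; have Hvw := H1ZD d Hv Hw.
  rewrite /H1_sqr (L2_inner_linear mO d Lv Lw (L2D d Lv Lw)).
  rewrite (L2_inner_linearr d Lv Lw Lv) (L2_inner_linearr d Lv Lw Lw).
  rewrite (grad_inner_linear d Hv Hw Hvw).
  rewrite [grad_inner _ v (_ + _)]grad_innerC [grad_inner _ w (_ + _)]grad_innerC.
  rewrite (grad_inner_linear d Hv Hw Hv) (grad_inner_linear d Hv Hw Hw).
  rewrite (L2_innerC Omega w v) (grad_innerC w v).
  move: (ip v v) (ip v w) (ip w w).
  move: (grad_inner Omega v v) (grad_inner Omega v w) (grad_inner Omega w w).
  by move=> *; ring.
have := H1_sqr_ge0 (- c *: v + w); rewrite !e sqrrN.
move: (H1_sqr v) (H1_sqr w) (ip v w + grad_inner Omega v w) => A B D; lra.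
Qed.

Lemma H10P v : H10 Omega v <-> H1 Omega v /\ forall eps : R, 0 < eps ->
  exists2 phi, test_function Omega phi &
    ip (v - phi) (v - phi) + grad_inner Omega (v - phi) (v - phi) < eps.
Proof.
split=> -[Hv Av]; split=> // eps e0.
  have [|phi tphi] := Av (Num.sqrt eps); first by rewrite sqrtr_gt0.
  by rewrite H1_norm_lt ?sqrtr_gt0// sqr_sqrtr ?ltW//; exists phi.
have [|phi tphi h] := Av (eps ^+ 2); first by rewrite exprn_gt0.
by exists phi => //; rewrite H1_norm_lt.
Qed.

Lemma H10ZD c v w : H10 Omega v -> H10 Omega w -> H10 Omega (c *: v + w).
Proof.
move=> /H10P[Hv Av] /H10P[Hw Aw]; apply/H10P; split; first exact: H1ZD.
(* The squared error is at most [2 c^2 d + 2 d]; the [3] leaves room. *)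
move=> eps e0; pose d := eps / (2 * c ^+ 2 + 3).
have C0 : 0 < 2 * c ^+ 2 + 3 by have := sqr_ge0 c; lra.
have d0 : 0 < d by rewrite divr_gt0.
have [phi tphi vphi] := Av d d0; have [psi tpsi wpsi] := Aw d d0.
exists (c *: phi + psi); first exact: test_functionZD.
have -> : c *: v + w - (c *: phi + psi) = c *: (v - phi) + (w - psi).
  by rewrite scalerBr opprD addrACA.
have HB g h : H1 Omega g -> H1 Omega h -> H1 Omega (g - h).
  by move=> ? ?; rewrite addrC -scaleN1r; exact: H1ZD.
apply: le_lt_trans (H1_sqrZD c (HB _ _ Hv (H1_test tphi)) (HB _ _ Hw (H1_test tpsi))) _.
have -> : eps = d * (2 * c ^+ 2 + 3) by rewrite /d mulfVK// gt_eqF.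
move: vphi wpsi d0 (sqr_ge0 c); rewrite -!/(H1_sqr _).
move: (H1_sqr _) (H1_sqr _) (c ^+ 2) d => A B C D /ltW hA hB D0 hC.
by have := ler_wpM2l hC hA; lra.
Qed.
End SobolevSpaces.

(** * The Dirichlet problem *)

Lemma sum_ord2 (E : nmodType) (F : 'I_2 -> E) : \sum_(i < 2) F i = F ord0 + F ord_max.
Proof. by rewrite big_ord_recl big_ord1; congr (_ + F _); exact/val_inj. Qed.

Lemma harmonic_small {R : realType} (e : R) : 0 < e ->
  exists N, forall n, (N <= n)%N -> n.+1%:R^-1 <= e.
Proof.
move=> e0; have [N] := ltr_add_invr e0; rewrite add0r => Ne; exists N => n Nn.
by apply/ltW/(le_lt_trans _ Ne); rewrite lef_pV2 ?posrE ?ltr0n// ler_nat.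
Qed.

Lemma cvg_of_sqr_le {R : realType} (u : nat -> R) (l A : R) :
  (forall n, (u n - l) ^+ 2 <= A * n.+1%:R^-1) -> u @ \oo --> l.
Proof.
move=> uA; have A0 : 0 <= A by have := le_trans (sqr_ge0 _) (uA 0%N); rewrite invr1 mulr1.
apply/cvgrPdist_le => e e0; have A1 : 0 < A + 1 by rewrite ltr_wpDl.
have [|N NP] := @harmonic_small R (e ^+ 2 / (A + 1)); first by rewrite divr_gt0 ?exprn_gt0.
exists N => // n /= /NP h; rewrite distrC.
rewrite -ler_sqr ?nnegrE// ?(ltW e0)// real_normK ?num_real//.
apply: le_trans (uA n) _; move: h; rewrite ler_pdivlMr//; apply: le_trans.
by rewrite mulrC; apply: ler_wpM2l; [rewrite invr_ge0|rewrite lerDl].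
Qed.

Section Poisson.
Context {R : realType} (Omega : set (R * R)).
Local Notation plane := (measurableTypeR R * measurableTypeR R)%type.
Hypothesis oO : open Omega.
Hypothesis bO : bounded_set Omega.
Local Notation mu := (lebesgue2 R).
Local Notation ip := (L2_inner Omega).
Let mO : measurable (Omega : set plane) := open_measurable2 oO.
Implicit Types (phi psi v w g z : R * R -> R) (i : 'I_2) (c : R).
Local Notation "v =ae w" := {ae mu, forall x, Omega x -> v x = w x} (at level 70).

Let L2t phi : test_function Omega phi -> L2 Omega phi.
Proof. exact: L2_test. Qed.

Let tpartial i phi : test_function Omega phi -> test_function Omega (partial i phi).
Proof. exact: test_function_partial. Qed.

Let test_laplace phi : test_function Omega phi ->
  test_function Omega (\sum_(i < 2) partial i (partial i phi)).
Proof.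
move=> tphi; have tt i := tpartial i (tpartial i tphi).
by have := test_functionZD bO 1 (tt ord0) (tt ord_max); rewrite sum_ord2 scale1r.
Qed.

Let L2_inner_laplace v phi : L2 Omega v -> test_function Omega phi ->
  ip v (\sum_(i < 2) partial i (partial i phi)) = \sum_(i < 2) ip v (partial i (partial i phi)).
Proof.
move=> Lv tphi; have Lp i := L2t (tpartial i (tpartial i tphi)).
have := L2_inner_linearr oO 1 (Lp ord0) (Lp ord_max) Lv.
by rewrite !sum_ord2 scale1r mul1r.
Qed.

Lemma laplacianP v : V Omega v ->
  L2 Omega (laplacian Omega v) /\ weak_laplacian Omega v (laplacian Omega v).
Proof.
move=> [_ [w Lw vw]].
exact: (@xgetPex _ (cst 0) [set w | L2 Omega w /\ weak_laplacian Omega v w]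
  (ex_intro _ w (conj Lw vw))).
Qed.

Lemma laplacian_ae v w : V Omega v -> L2 Omega w -> weak_laplacian Omega v w ->
  laplacian Omega v =ae w.
Proof.
move=> Vv Lw vw; have [Ll vl] := laplacianP Vv.
by apply: ae_eq_of_test => // phi tphi; rewrite -vw// vl.
Qed.

Let VL2 v : V Omega v -> L2 Omega v.
Proof. by case=> -[[]]. Qed.

Let weak_laplacianZD c v w : V Omega v -> V Omega w ->
  weak_laplacian Omega (c *: v + w) (c *: laplacian Omega v + laplacian Omega w).
Proof.
move=> Vv Vw phi tphi; have [Lv vl] := laplacianP Vv; have [Lw wl] := laplacianP Vw.
rewrite (L2_inner_linear mO c (VL2 Vv) (VL2 Vw) (L2t (test_laplace tphi))).
by rewrite (L2_inner_linear mO c Lv Lw (L2t tphi)) vl// wl.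
Qed.

Lemma VZD c v w : V Omega v -> V Omega w -> V Omega (c *: v + w).
Proof.
move=> Vv Vw; have [Lv _] := laplacianP Vv; have [Lw _] := laplacianP Vw.
split; first by apply: H10ZD; [| |case: Vv|case: Vw].
exists (c *: laplacian Omega v + laplacian Omega w); first exact: L2ZD.
exact: weak_laplacianZD.
Qed.

Lemma laplacianZD c v w : V Omega v -> V Omega w ->
  laplacian Omega (c *: v + w) =ae c *: laplacian Omega v + laplacian Omega w.
Proof.
move=> Vv Vw; have [Lv _] := laplacianP Vv; have [Lw _] := laplacianP Vw.
by apply: laplacian_ae; [exact: VZD|exact: L2ZD|exact: weak_laplacianZD].
Qed.

Lemma L2_inner_laplacianZD c v w z : V Omega v -> V Omega w -> L2 Omega z ->
  ip (laplacian Omega (c *: v + w)) z = c * ip (laplacian Omega v) z + ip (laplacian Omega w) z.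
Proof.
move=> Vv Vw Lz; have [Lv _] := laplacianP Vv; have [Lw _] := laplacianP Vw.
rewrite -(L2_inner_linear mO c Lv Lw Lz); apply: (ae_L2_inner2 oO _ _ Lz Lz).
- by have [] := laplacianP (VZD c Vv Vw).
- exact: L2ZD.
- exact: laplacianZD.
- exact: aeW.
Qed.

(** An exact equality although gradients and Laplacians are linear only almost everywhere: the
    functional sees them through integrals. Hence the linearity of [u] applies. *)
Lemma normal_derivativeZD c v w : V Omega v -> V Omega w ->
  normal_derivative Omega (c *: v + w) =
  c *: normal_derivative Omega v + normal_derivative Omega w.
Proof.
move=> Vv Vw; apply/funext => -[chi Hchi]; rewrite !fctE /normal_derivative /=.
have {}Hchi : H1 Omega chi by rewrite inE in Hchi.
rewrite (grad_inner_linear oO bO c Vv.1.1 Vw.1.1 Hchi).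
rewrite (L2_inner_laplacianZD c Vv Vw Hchi.1) /GRing.scale/= mulrDr.
exact: addrACA.
Qed.

Lemma V0 : V Omega (0 : R * R -> R).
Proof.
have H0 : H1 Omega (0 : R * R -> R) by apply: H1_test => //; exact: test_function0.
split; last by exists 0; [exact: (L2_0 mO)|move=> phi _; rewrite !L2_inner0].
apply/H10P; split => // eps e0; exists 0; first exact: test_function0.
have := grad_inner_linear oO bO 1 H0 H0 H0.
rewrite scale1r addr0 subrr L2_inner0 add0r mul1r.
by move: (grad_inner Omega 0 0) => A; lra.
Qed.

(* [x_1] has derivative [1], so integrating [phi^2] by parts against it gives
   [|phi|^2 = - 2 (x_1 phi, d_1 phi)]. *)
Lemma poincare : exists2 C : R, 0 <= C & forall phi, test_function Omega phi ->
  ip phi phi <= C * ip (partial ord0 phi) (partial ord0 phi).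
Proof.
have [M M0 MO] := bounded_in_box bO.
(* With [A = |phi|^2] and [D = |d_1 phi|^2], Cauchy-Schwarz and [|x_1| <= M] give [A^2 = 4 (x_1 phi,
   d_1 phi)^2 <= 4 M^2 A D]; it remains to divide by [A]. *)
exists (4 * M ^+ 2) => [|phi tphi]; first by rewrite mulr_ge0 ?sqr_ge0.
set d := partial ord0 phi; have td : test_function Omega d by exact: tpartial.
have cphi := test_continuous tphi; have cd := test_continuous td.
have cx : continuous (coord ord0 : R * R -> R) by exact: coord_continuous.
pose k : R * R -> R := coord ord0 * phi.
have ck : continuous k by move=> x; apply: continuousM; [exact: cx|exact: cphi].
have cxd : continuous (coord ord0 * d : R * R -> R).
  by move=> x; apply: continuousM; [exact: cx|exact: cd].
have Lk := L2_continuous oO bO ck; have Lphi := L2t tphi; have Ld := L2t td.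
have Lxd := L2_continuous oO bO cxd.
have wk : weak_partial Omega ord0 k (1 *: phi + coord ord0 * d).
  apply: classical_weak_partial => // [x|x].
    by rewrite scale1r; apply: continuousD; [exact: cphi|exact: cxd].
  have dx : is_derive x (basis_vec ord0) (coord ord0 : R * R -> R) 1.
    by apply/is_derive_line; rewrite (_ : _ \o _ = id).
  apply: (is_derive_eq (is_deriveM dx (test_is_derive ord0 x tphi))).
  by rewrite scale1r !fctE [X in _ + X]mulr1 addrC.
have e : ip (coord ord0 * d) phi = ip k d.
  by apply: eq_Rintegral => x _; rewrite /k !fctE mulrAC.
have := wk phi tphi; rewrite -/d (L2_inner_linear mO 1 Lphi Lxd Lphi) e mul1r => kd.
have pp : ip phi phi = - 2 * ip k d by lra.
have kk : ip k k <= M ^+ 2 * ip phi phi.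
  rewrite /L2_inner -RintegralZl//; last exact: (L2_integrable_mul mO Lphi Lphi).
  apply: le_Rintegral => //.
  - exact: (L2_integrable_mul mO Lk Lk).
  - exact: (integrableZl mO (M ^+ 2) (L2_integrable_mul mO Lphi Lphi)).
  move=> x /MO[/=]; rewrite in_itv/= => /andP[? ?] _.
  rewrite /k !fctE /coord/= -!expr2 exprMn ler_wpM2r ?sqr_ge0//.
  by rewrite -subr_ge0 subr_sqr mulr_ge0//; lra.
have := L2_inner_CS mO Lk Ld.
have := L2_inner_ge0 Omega phi; have := L2_inner_ge0 Omega d.
move: pp kk; move: (ip phi phi) (ip k d) (ip k k) (ip d d) => A B C D AB CA D0 A0 BCD.
have [A00|AN0] := eqVneq A 0; first by rewrite A00; have := sqr_ge0 M; nra.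
have Agt0 : 0 < A by rewrite lt_neqAle eq_sym AN0.
rewrite -(ler_pM2l Agt0); have -> : A * A = 4 * B ^+ 2 by rewrite AB; ring.
apply: (@le_trans _ _ (4 * (C * D))); first by rewrite ler_wpM2l.
have := ler_wpM2r D0 CA; lra.
Qed.

Lemma L2_cvg_inner (u : nat -> R * R -> R) v z : (forall n, L2 Omega (u n)) ->
  L2 Omega v -> L2 Omega z ->
  (forall e : R, 0 < e -> exists N, forall n, (N <= n)%N -> ip (u n - v) (u n - v) <= e) ->
  ip (u n) z @[n --> \oo] --> ip v z.
Proof.
move=> Lu Lv Lz uv; apply/cvgrPdist_le => e e0.
have Z0 : 0 < ip z z + 1 by rewrite ltr_wpDl// L2_inner_ge0.
have [|N NP] := uv (e ^+ 2 / (ip z z + 1)); first by rewrite divr_gt0 ?exprn_gt0.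
exists N => // n /= /NP h; rewrite distrC -(L2_innerBl oO (Lu n) Lv Lz).
rewrite -ler_sqr ?nnegrE// ?(ltW e0)// real_normK ?num_real//.
apply: le_trans (L2_inner_CS mO (L2B oO (Lu n) Lv) Lz) _.
move: h; rewrite ler_pdivlMr//; apply: le_trans; apply: ler_wpM2l; last by rewrite lerDl.
exact: L2_inner_ge0.
Qed.

(** The functional is [- (w, phi)], bounded in energy by Poincare. Poincare also makes the sequence
    itself Cauchy in [L^2]; weak derivatives pass to the limit, and the same sequence witnesses
    membership in [H^1_0]. *)
Lemma poisson w : L2 Omega w -> exists2 v, V Omega v & laplacian Omega v =ae w.
Proof.
move=> Lw; have [C C0 CP] := poincare.
pose a phi psi := \sum_(i < 2) ip (partial i phi) (partial i psi).
have partialZD i c phi psi : test_function Omega phi -> test_function Omega psi ->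
    partial i (c *: phi + psi) = c *: partial i phi + partial i psi.
  move=> tphi tpsi; apply/funext => x.
  have := is_deriveD (is_deriveZ c (test_is_derive i x tphi)) (test_is_derive i x tpsi).
  by case.
have a_ge (i : 'I_2) phi : ip (partial i phi) (partial i phi) <= a phi phi.
  by rewrite /a (bigD1 i)//= lerDl sumr_ge0// => j _; exact: L2_inner_ge0.
have [k [tk ka kF]] : exists k : nat -> R * R -> R,
  [/\ forall n, test_function Omega (k n),
      forall n m, a (k n - k m) (k n - k m) <= 2 * (n.+1%:R^-1 + m.+1%:R^-1) &
      forall n x, test_function Omega x -> (a (k n) x - (- ip w x)) ^+ 2 <= a x x * n.+1%:R^-1].
  apply: minimizing_sequence.
  - exact: test_function0.
  - by move=> c x y; exact: test_functionZD.
  - by move=> x y _ _; apply: eq_bigr => i _; exact: L2_innerC.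
  - move=> c x y z tx ty tz; rewrite /a mulr_sumr -big_split; apply: eq_bigr => i _ /=.
    rewrite partialZD//.
    exact: (L2_inner_linear mO c (L2t (tpartial i tx)) (L2t (tpartial i ty)) (L2t (tpartial i tz))).
  - by move=> x _; apply: sumr_ge0 => i _; exact: L2_inner_ge0.
  - move=> c x y tx ty; rewrite (L2_inner_linearr oO c (L2t tx) (L2t ty) Lw).
    by rewrite opprD mulrN.
  - exists (ip w w * C) => x tx; rewrite sqrrN.
    apply: le_trans (L2_inner_CS mO Lw (L2t tx)) _.
    rewrite -mulrA; apply: ler_wpM2l; first exact: L2_inner_ge0.
    apply: le_trans (CP _ tx) _; apply: ler_wpM2l => //; exact: a_ge.
have tkB n m : test_function Omega (k n - k m).
  by rewrite addrC -scaleN1r; exact: test_functionZD.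
have a_cauchy (e : R) : 0 < e -> exists N, forall n m, (N <= n)%N -> (N <= m)%N ->
    a (k n - k m) (k n - k m) <= e.
  move=> e0; have [|N NP] := harmonic_small (_ : 0 < e / 4); first by rewrite divr_gt0.
  exists N => n m /NP hn /NP hm; apply: le_trans (ka n m) _.
  by move: hn hm; move: (n.+1%:R^-1) (m.+1%:R^-1) => A B; lra.
have [v Lv kv] : exists2 v, L2 Omega v & forall e : R, 0 < e -> exists N, forall n, (N <= n)%N ->
    ip (k n - v) (k n - v) <= e.
  apply: (L2_complete mO) => [n|e e0]; first exact: L2t.
  have [|N NP] := a_cauchy (e / (C + 1)); first by rewrite divr_gt0// ltr_wpDl.
  exists N => n m Nn Nm; apply: le_trans (CP _ (tkB n m)) _.
  have := le_trans (a_ge ord0 _) (NP n m Nn Nm); rewrite ler_pdivlMr ?ltr_wpDl//.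
  have := L2_inner_ge0 Omega (partial ord0 (k n - k m)).
  by move: (ip _ _) => A A0; lra.
have partialB i n m : partial i (k n - k m) = partial i (k n) - partial i (k m).
  have := partialZD i (-1) (k m) (k n) (tk m) (tk n).
  by rewrite !scaleN1r [- _ + k n]addrC [- _ + partial i (k n)]addrC.
have cvg_partial i : exists g, L2 Omega g /\ forall e : R, 0 < e -> exists N,
    forall n, (N <= n)%N -> ip (partial i (k n) - g) (partial i (k n) - g) <= e.
  have [|e e0|g Lg gk] := @L2_complete _ _ mO (fun n => partial i (k n)).
  - by move=> n; exact/L2t/tpartial.
  - have [N NP] := a_cauchy e e0; exists N => n m Nn Nm.
    by rewrite -partialB; exact: le_trans (a_ge i _) (NP n m Nn Nm).
  - by exists g.
have [g gP] := choice cvg_partial.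
have Lg i := (gP i).1; have gk i := (gP i).2.
have wpv i : weak_partial Omega i v (g i).
  move=> phi tphi.
  have c1 := L2_cvg_inner (fun n => L2t (tk n)) Lv (L2t (tpartial i tphi)) kv.
  have c2 := L2_cvg_inner (fun n => L2t (tpartial i (tk n))) (Lg i) (L2t tphi) (gk i).
  apply: (cvg_unique _ c1) => //; rewrite (_ : (fun n => _) = fun n => - ip (partial i (k n)) phi).
    exact: cvgN c2.
  by apply/funext => n; rewrite (test_weak_partial oO bO i (tk n) tphi).
have H1v : H1 Omega v by split=> // i; exists (g i).
have a_lim phi : test_function Omega phi ->
    a (k n) phi @[n --> \oo] --> \sum_(i < 2) ip (g i) (partial i phi).
  move=> tphi; rewrite sum_ord2 (_ : (fun n => _) = fun n =>
    ip (partial ord0 (k n)) (partial ord0 phi) + ip (partial ord_max (k n)) (partial ord_max phi)).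
    have c i := L2_cvg_inner (fun n => L2t (tpartial i (tk n))) (Lg i)
      (L2t (tpartial i tphi)) (gk i).
    by apply: cvgD; exact: c.
  by apply/funext => n; rewrite /a sum_ord2.
have aF phi : test_function Omega phi -> \sum_(i < 2) ip (g i) (partial i phi) = - ip w phi.
  move=> tphi; apply: (cvg_unique _ (a_lim _ tphi)) => //.
  exact: cvg_of_sqr_le (fun n => kF n phi tphi).
have weak : weak_laplacian Omega v w.
  (* The derivatives of [phi] are again test functions, so [(v, d_i d_i phi) = - (g_i, d_i phi)],
     and the limit equation applies. *)
  move=> phi tphi; rewrite L2_inner_laplace//; apply: oppr_inj; rewrite -aF// -sumrN.
  by apply: eq_bigr => i _; rewrite (wpv i) ?opprK//; exact: tpartial.
have Vv : V Omega v.
  split; last by exists w.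
  apply/H10P; split => // e e0.
  have e3 : 0 < e / 4 by rewrite divr_gt0.
  have [N0 N0P] := kv _ e3; have [N1 N1P] := gk ord0 _ e3; have [N2 N2P] := gk ord_max _ e3.
  (* Past all three thresholds each of the three squared errors is at most [e / 4]. *)
  pose n := (N0 + N1 + N2)%N; exists (k n) => //.
  have sym (f h : R * R -> R) : L2 Omega f -> L2 Omega h -> ip (f - h) (f - h) = ip (h - f) (h - f).
    by move=> Lf Lh; apply: eq_Rintegral => x _; rewrite !fctE -mulrNN !opprB.
  have Hvk : H1 Omega (v - k n).
    by rewrite addrC -scaleN1r; apply: H1ZD => //; exact: H1_test.
  rewrite (grad_inner_ae (g := fun i => g i - partial i (k n)) oO bO Hvk); last 2 first.
  - by move=> i; apply: (L2B oO) => //; exact/L2t/tpartial.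
  - have ZB (f h : R * R -> R) : f - h = -1 *: h + f by rewrite scaleN1r addrC.
    move=> i; rewrite (ZB v) (ZB (g i)).
    apply: (weak_partialZD oO bO) => //; [exact: L2t|exact/L2t/tpartial|].
    exact: test_weak_partial.
  rewrite sum_ord2 (sym v (k n) Lv (L2t (tk n))).
  rewrite (sym _ _ (Lg ord0) (L2t (tpartial ord0 (tk n)))).
  rewrite (sym _ _ (Lg ord_max) (L2t (tpartial ord_max (tk n)))).
  have n0 : (N0 <= n)%N by rewrite /n -addnA leq_addr.
  have n1 : (N1 <= n)%N by rewrite /n addnAC leq_addl.
  have n2 : (N2 <= n)%N by rewrite /n leq_addl.
  move: (N0P n n0) (N1P n n1) (N2P n n2).
  by move: (ip _ _) (ip _ _) (ip _ _) => A B D; lra.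
by exists v => //; exact: laplacian_ae.
Qed.
End Poisson.

(** * Very weak solutions *)

(** If the supremum does not exist, [sup] takes its default value [0]. *)
Lemma dual_norm_ge0 {R : realType} {E : lmodType R} (S : set E) (N f : E -> R) :
  0 <= dual_norm S N f.
Proof.
rewrite /dual_norm; set A := [set _ | _ in _]; have [supA|] := pselect (has_sup A).
  have [[x Ax] ubA] := supA; apply: le_trans (ub_le_sup ubA Ax).
  by have [y _ <-] := Ax.
by move=> /sup_out ->.
Qed.

Section VeryWeak.
Context {R : realType} (Omega : set (R * R)).
Hypothesis oO : open Omega.
Hypothesis bO : bounded_set Omega.
Local Notation plane := (measurableTypeR R * measurableTypeR R)%type.
Let mO : measurable (Omega : set plane) := open_measurable2 oO.
Local Notation mu := (lebesgue2 R).
Local Notation ip := (L2_inner Omega).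

Lemma V_norm_sqrt v : V Omega v ->
  V_norm Omega v = Num.sqrt (ip (laplacian Omega v) (laplacian Omega v)).
Proof. by move=> /laplacianP[Ll _]; exact: L2_norm_sqrt. Qed.

Lemma V_norm_ge0 v : V Omega v -> 0 <= V_norm Omega v.
Proof. by move=> Vv; rewrite V_norm_sqrt ?sqrtr_ge0. Qed.

Lemma V_normZ c v : V Omega v -> V_norm Omega (c *: v) = `|c| * V_norm Omega v.
Proof.
move=> Vv; have V0' := V0 oO bO.
have Vcv : V Omega (c *: v) by rewrite -[_ *: _]addr0; exact: VZD.
have [Ll _] := laplacianP Vv; have [Lcl _] := laplacianP Vcv.
have [L0 _] := laplacianP V0'.
have e z : L2 Omega z -> ip (laplacian Omega (c *: v)) z = c * ip (laplacian Omega v) z.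
  move=> Lz; rewrite -[c *: v]addr0 (L2_inner_laplacianZD oO bO c Vv V0' Lz).
  have := L2_inner_laplacianZD oO bO 1 V0' V0' Lz; rewrite scaler0 addr0.
  by move: (ip _ z) => A; lra.
rewrite !V_norm_sqrt// e// L2_innerC e// mulrA -expr2 sqrtrM ?sqr_ge0//.
by rewrite sqrtr_sqr.
Qed.

(** Normalizing [v] carries the bound from the unit ball to [V]. A [v] of norm [0] cannot be
    normalized; there the crude bound with [C] forces [G v = 0]. *)
Lemma le_unit_ball_bound (G : (R * R -> R) -> R) (C S : R) :
  (forall c v w, V Omega v -> V Omega w -> G (c *: v + w) = c * G v + G w) ->
  (forall v, V Omega v -> `|G v| <= C * V_norm Omega v) ->
  (forall v, V Omega v -> V_norm Omega v <= 1 -> `|G v| <= S) ->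
  forall v, V Omega v -> `|G v| <= S * V_norm Omega v.
Proof.
move=> G_lin GC GS v Vv; have V0' := V0 oO bO.
have GZ c w : V Omega w -> G (c *: w) = c * G w.
  move=> Vw; have := G_lin 1 0 0 V0' V0'; have := G_lin c w 0 Vw V0'.
  by rewrite scaler0 !addr0 mul1r; move: (G 0) => A; lra.
have [n0|n0] := leP (V_norm Omega v) 0.
  have {}n0 : V_norm Omega v = 0 by apply/le_anti; rewrite n0 V_norm_ge0.
  by apply: le_trans (GC v Vv) _; rewrite n0 !mulr0.
pose n := V_norm Omega v; have Vnv : V Omega (n^-1 *: v).
  by rewrite -[_ *: _]addr0; exact: VZD.
have := GS _ Vnv; rewrite (V_normZ _ Vv) (GZ _ _ Vv) normrM ger0_norm ?invr_ge0 ?(ltW n0)//.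
by rewrite mulVf ?gt_eqF// lexx => /(_ isT); rewrite ler_pdivrMl// mulrC.
Qed.

Let le_unit (C N : R) : 0 <= N -> N <= 1 -> C * N <= `|C|.
Proof.
move=> N0 N1; apply: (@le_trans _ _ (`|C| * N)); first by rewrite ler_wpM2r// ler_norm.
by rewrite ler_piMr.
Qed.

Lemma dual_le (f : (R * R -> R) -> R) v :
  dual (V Omega) (V_norm Omega) f -> V Omega v ->
  `|f v| <= dual_norm (V Omega) (V_norm Omega) f * V_norm Omega v.
Proof.
move=> [f_lin [C fC]]; apply: (le_unit_ball_bound f_lin fC) => //.
move=> w Vw w1; apply: ub_le_sup; last by exists w.
exists `|C| => _ [z [Vz z1] <-]; apply: le_trans (fC z Vz) _.
by apply: le_unit => //; exact: V_norm_ge0.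
Qed.

Lemma VGamma_norm_ge0 g : VGamma Omega g -> 0 <= VGamma_norm Omega g.
Proof.
move=> [v Vv vg]; apply: lb_le_inf; first by exists (V_norm Omega v), v.
by move=> _ [w [Vw _] <-]; exact: V_norm_ge0.
Qed.

Lemma VGamma_norm_le v : V Omega v ->
  VGamma_norm Omega (normal_derivative Omega v) <= V_norm Omega v.
Proof.
move=> Vv; apply: ge_inf; last by exists v.
by exists 0 => _ [w [Vw _] <-]; exact: V_norm_ge0.
Qed.

Lemma dual_VGamma_linear (u : (H1 Omega -> R) -> R) c v w :
  dual (VGamma Omega) (VGamma_norm Omega) u -> V Omega v -> V Omega w ->
  u (normal_derivative Omega (c *: v + w)) =
    c * u (normal_derivative Omega v) + u (normal_derivative Omega w).
Proof.
by move=> [u_lin _] Vv Vw; rewrite normal_derivativeZD// u_lin//; [exists v|exists w].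
Qed.

(** The normal derivative maps the unit ball of [V] into that of [V_Gamma], so the pullback of [u]
    to [V] is bounded there by the dual norm of [u]. *)
Lemma dual_VGamma_le (u : (H1 Omega -> R) -> R) v :
  dual (VGamma Omega) (VGamma_norm Omega) u -> V Omega v ->
  `|u (normal_derivative Omega v)| <=
    dual_norm (VGamma Omega) (VGamma_norm Omega) u * V_norm Omega v.
Proof.
move=> du; have [u_lin [C uC]] := du; move: v.
have uV v : V Omega v -> VGamma Omega (normal_derivative Omega v) by exists v.
(* Passing from the norm of [V_Gamma] to that of [V] multiplies an inequality by the constant, which
   must be nonnegative. *)
apply: (@le_unit_ball_bound (fun v => u (normal_derivative Omega v)) `|C|) => [c v w|w Vw|w Vw w1].
- exact: dual_VGamma_linear.
- apply: le_trans (uC _ (uV w Vw)) _.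
  apply: (@le_trans _ _ (`|C| * VGamma_norm Omega (normal_derivative Omega w))).
    by rewrite ler_wpM2r ?ler_norm//; apply: VGamma_norm_ge0; exact: uV.
  by rewrite ler_wpM2l// VGamma_norm_le.
- apply: ub_le_sup; last first.
    exists (normal_derivative Omega w) => //; split; first exact: uV.
    exact: le_trans (VGamma_norm_le Vw) w1.
  exists `|C| => _ [g [Vg g1] <-]; apply: le_trans (uC g Vg) _.
  by apply: le_unit => //; exact: VGamma_norm_ge0.
Qed.

(** The Laplacians of a minimizing sequence in [V] are Cauchy in [L^2], and [y] is their limit; no
    limit is taken in [V]. *)
Lemma L2_riesz (F : (R * R -> R) -> R) (M : R) :
  (forall c v w, V Omega v -> V Omega w -> F (c *: v + w) = c * F v + F w) ->
  (forall v, V Omega v -> `|F v| <= M * V_norm Omega v) ->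
  exists2 y, L2 Omega y & forall v, V Omega v -> ip y (laplacian Omega v) = F v.
Proof.
move=> F_lin FM.
have Ll v : V Omega v -> L2 Omega (laplacian Omega v) by case/laplacianP.
pose a v w := ip (laplacian Omega v) (laplacian Omega w).
have [k [Vk ka kF]] : exists k : nat -> R * R -> R,
  [/\ forall n, V Omega (k n),
      forall n m, a (k n - k m) (k n - k m) <= 2 * (n.+1%:R^-1 + m.+1%:R^-1) &
      forall n v, V Omega v -> (a (k n) v - F v) ^+ 2 <= a v v * n.+1%:R^-1].
  apply: minimizing_sequence.
  - exact: V0.
  - by move=> c v w; exact: VZD.
  - by move=> v w _ _; exact: L2_innerC.
  - move=> c v w z Vv Vw Vz; exact: (L2_inner_laplacianZD oO bO c Vv Vw (Ll z Vz)).
  - by move=> v _; exact: L2_inner_ge0.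
  - exact: F_lin.
  - exists (M ^+ 2) => v Vv.
    rewrite -[F v ^+ 2]real_normK ?num_real//.
    have -> : M ^+ 2 * a v v = (M * V_norm Omega v) ^+ 2.
      by rewrite exprMn V_norm_sqrt// sqr_sqrtr// L2_inner_ge0.
    by rewrite lerXn2r ?nnegrE// ?FM// (le_trans _ (FM v Vv)).
(* The Laplacian of the difference and the difference of the Laplacians agree only almost
   everywhere, so the equality goes through the integrals. *)
have aB n m : ip (laplacian Omega (k n) - laplacian Omega (k m))
    (laplacian Omega (k n) - laplacian Omega (k m)) = a (k n - k m) (k n - k m).
  have ZB (f h : R * R -> R) : f - h = -1 *: h + f by rewrite scaleN1r addrC.
  have LZ := L2ZD mO (-1) (Ll _ (Vk m)) (Ll _ (Vk n)).
  have VB := VZD oO bO (-1) (Vk m) (Vk n).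
  have e := laplacianZD oO bO (-1) (Vk m) (Vk n).
  rewrite !ZB; apply/esym.
  exact: (ae_L2_inner2 oO (Ll _ VB) LZ (Ll _ VB) LZ e e).
have [y Ly ky] : exists2 y, L2 Omega y & forall e : R, 0 < e -> exists N, forall n, (N <= n)%N ->
    ip (laplacian Omega (k n) - y) (laplacian Omega (k n) - y) <= e.
  apply: (L2_complete mO) => [n|e e0]; first exact: Ll.
  have [N NP] := harmonic_small (divr_gt0 e0 (ltr0Sn R 3)).
  exists N => n m /NP hn /NP hm; rewrite aB; apply: le_trans (ka n m) _.
  by move: hn hm; move: (n.+1%:R^-1) (m.+1%:R^-1) => A B; lra.
exists y => // v Vv.
have c1 := L2_cvg_inner oO (fun n => Ll _ (Vk n)) Ly (Ll v Vv) ky.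
apply: (cvg_unique _ c1) => //; exact: cvg_of_sqr_le (fun n => kF n v Vv).
Qed.
End VeryWeak.

Theorem lemma2p3 (R : realType) (Omega : set (R * R))
  (Omega_poly : bounded_polygonal_domain Omega)
  (Omega_corner : at_most_one_nonconvex_corner Omega)
  (f : (R * R -> R) -> R) (u : (H1 Omega -> R) -> R)
  (f_dual : dual (V Omega) (V_norm Omega) f)
  (u_dual : dual (VGamma Omega) (VGamma_norm Omega) u) :
  let very_weak_solution (y : R * R -> R) :=
    forall v, V Omega v ->
      L2_inner Omega y (laplacian Omega v) = u (normal_derivative Omega v) - f v in
  exists y : R * R -> R,
    [/\ L2 Omega y,
        very_weak_solution y,
        forall z, L2 Omega z -> very_weak_solution z ->
          {ae lebesgue2 R, forall x, Omega x -> z x = y x} &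
        L2_norm Omega y <=
          dual_norm (VGamma Omega) (VGamma_norm Omega) u
          + dual_norm (V Omega) (V_norm Omega) f].
Proof.
move=> very_weak_solution; have [[oO _ _ bO] _] := Omega_poly.
have mO := open_measurable2 oO.
pose M := dual_norm (VGamma Omega) (VGamma_norm Omega) u + dual_norm (V Omega) (V_norm Omega) f.
pose F v := u (normal_derivative Omega v) - f v.
have F_le v : V Omega v -> `|F v| <= M * V_norm Omega v.
  move=> Vv; rewrite /M mulrDl; apply: le_trans (ler_normB _ _) _.
  by apply: lerD; [exact: dual_VGamma_le|exact: dual_le].
have [|y Ly yF] := L2_riesz oO bO _ F_le.
  move=> c v w Vv Vw; apply: etrans (congr2 (fun s t => s - t)
    (dual_VGamma_linear oO bO c u_dual Vv Vw) (f_dual.1 c v w Vv Vw)) _.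
  have lin (s t s' t' : R) : c * s + t - (c * s' + t') = c * (s - s') + (t - t') by ring.
  exact: lin.
exists y; split => //.
- move=> z Lz zF; have Lzy := L2B oO Lz Ly.
  (* Both solutions are tested with the [v] whose Laplacian is their difference. *)
  have [v Vv vzy] := poisson oO bO Lzy; have [Ll _] := laplacianP Vv.
  have : L2_inner Omega (z - y) (z - y) = 0.
    rewrite -(ae_L2_inner2 oO Lzy Lzy Ll Lzy (aeW _ (fun x _ => erefl)) vzy).
    by rewrite (L2_innerBl oO Lz Ly Ll) zF// yF// subrr.
  move=> /(L2_inner_eq0 mO Lzy); apply: ae_imply => x /[apply] /eqP.
  by rewrite subr_eq0 => /eqP.
(* Testing with [laplacian v = y] gives [|y|^2 = F v <= M |v|_V = M |y|]. *)
- have [v Vv vy] := poisson oO bO Ly; have [Ll _] := laplacianP Vv.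
  have aey : {ae lebesgue2 R, forall x, Omega x -> y x = y x} by exact: aeW.
  have yy : L2_inner Omega y y = F v.
    by rewrite -(yF v Vv); apply/esym; exact: (ae_L2_inner2 oO Ly Ly Ll Ly aey vy).
  have nv : V_norm Omega v = L2_norm Omega y.
    rewrite V_norm_sqrt// (L2_norm_sqrt mO Ly); congr Num.sqrt.
    exact: (ae_L2_inner2 oO Ll Ly Ll Ly vy vy).
  have n0 : 0 <= L2_norm Omega y by rewrite (L2_norm_sqrt mO Ly) sqrtr_ge0.
  have nn : L2_norm Omega y ^+ 2 <= M * L2_norm Omega y.
    rewrite {1}(L2_norm_sqrt mO Ly) sqr_sqrtr ?L2_inner_ge0// yy -nv.
    exact: le_trans (ler_norm _) (F_le v Vv).
  (* Dividing by [|y|] requires [|y| > 0]; for [|y| = 0] the claim is [M >= 0]. *)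
  rewrite -/M; move: n0; rewrite le_eqVlt => /predU1P[n0|n0]; last first.
    by rewrite -(ler_pM2r n0) -expr2.
  by rewrite -n0 addr_ge0// dual_norm_ge0.
Qed.
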